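(* Let $f\in\mathbf I(\mathbb E^n)$ with Segre symbol $\sigma_f=[t;r;\tilde\sigma]$, and let $\varphi_R\in O(n-r)$ be an orthogonal map with Segre symbol $\tilde\sigma$ (e.g. the restriction of the linear part $A$ of $f$ to $\ker(A-I)^\perp$). Put $d=0$ if $t=e$ and $d=1$ if $t=h$. Then for every $k$, $$\Gamma_f(k)\cong\bigsqcup_{k_1+k_2=k} S_{\varphi_R}(k_1)\times\mathrm{Gr}_{k_2-d}(\mathbb E^{r-d}),$$ where $\mathrm{Gr}_j(\mathbb E^m)$ is the space of $j$-dimensional affine subspaces of $\mathbb E^m$ (empty if $j<0$ or $j>m$; $\mathrm{Gr}_0(\mathbb E^m)=\mathbb E^m$). In particular, if $f$ is hyperbolic then $\Gamma_f(0)=\emptyset$.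
   Context: $f(x)=Ax+a$ with $A\in O(n)$; $r=\dim\ker(A-I)$; $t=e$ (elliptic) if $f$ has a fixed point, $t=h$ (hyperbolic) otherwise; $\tilde\sigma$ is the Segre symbol of $A|_{\ker(A-I)^\perp}$ (multiset of $\dim_{\mathbb C}\ker(\cdot-\lambda)$ over distinct conjugate pairs of non-real eigenvalues plus $\dim\ker(\cdot+I)$ if $-1$ is an eigenvalue). $\Gamma_f(k)$ is the set of $k$-dimensional affine subspaces $p+W$ of $\mathbb E^n$ with $f(p+W)=p+W$; $S_B(k)$ is the set of $k$-dimensional $B$-invariant linear subspaces.
   Formalization: The orthogonal map φ_R is additionally required to have no eigenvalue 1 (ker(φ_R − I) = 0), as the restriction of A to ker(A−I)^⊥ does; the multiset σ̃ alone does not exclude it, and the claim fails otherwise. *)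

(* Defs.v *)
(* The Euclidean space E^n is modelled as row vectors
   'rV[R]_n over an arbitrary real closed field R (covers R = the reals). *)
From HB Require Import structures.
From mathcomp Require Import all_boot all_order all_algebra.
Set Implicit Arguments. Unset Strict Implicit. Unset Printing Implicit Defensive.
Import Order.TTheory GRing.Theory Num.Theory.
Local Open Scope ring_scope.

Definition kerdim (R : fieldType) (m : nat) (M : 'M[R]_m) : nat :=
  (m - \rank M)%N.

(* dim_C ker_C (B - lambda I) for lambda = a + i b, computed on the
   realification C^m = R^m (+) R^m: (B - lambda)(x + i y) = 0 iff
   [[B - a, b], [-b, B - a]] [x; y] = 0; the real kernel dimension is twice
   the complex one. *)
Definition ckerdim (R : fieldType) (m : nat) (B : 'M[R]_m) (a b : R) : nat :=
  ((m + m - \rank (block_mx (B - a%:M) (b%:M) (- b%:M) (B - a%:M))) %/ 2)%N.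

(* s is the Segre symbol \tilde\sigma of B: the multiset (seq up to perm) of
   dim_C ker(B - lambda) over the distinct conjugate pairs {lambda, conj lambda}
   of non-real eigenvalues (each pair represented by lambda = a + i b, b > 0),
   plus dim ker(B + I) if -1 is an eigenvalue. *)
Definition segre_tilde (R : rcfType) (m : nat) (B : 'M[R]_m) (s : seq nat) : Prop :=
  exists ls : seq (R * R),
    [/\ uniq ls,
        (forall a b : R, ((a, b) \in ls) = (0 < b) && (ckerdim B a b != 0%N)) &
        perm_eq s ([seq ckerdim B x.1 x.2 | x <- ls] ++
                   (if kerdim (B + 1%:M) != 0%N then [:: kerdim (B + 1%:M)]
                    else [::]))].

Definition orth_mx (R : rcfType) (m : nat) (B : 'M[R]_m) : Prop :=
  B *m B^T = 1%:M.

(* f(x) = A x + a, written for row vectors: x |-> x A^T + a. *)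
Definition aff_apply (R : rcfType) (n : nat) (A : 'M[R]_n) (a : 'rV[R]_n)
  (x : 'rV[R]_n) : 'rV[R]_n := x *m A^T + a.

Definition elliptic (R : rcfType) (n : nat) (A : 'M[R]_n) (a : 'rV[R]_n) : Prop :=
  exists p, aff_apply A a p = p.

(* A k-dimensional linear subspace W of R^m is encoded by the orthogonal
   projection P onto W (symmetric, idempotent, rank k); W = row space of P. *)
Definition is_proj (R : rcfType) (m k : nat) (P : 'M[R]_m) : Prop :=
  [/\ P^T = P, P *m P = P & \rank P = k].

(* A k-dimensional affine subspace p + W of E^m is encoded by (P, q) where P
   is the orthogonal projection onto W and q in W^perp is its foot point
   (so p + W = q + W). This encoding gives the standard topology of the
   affine Grassmannian as a subspace of 'M_m * 'rV_m. *)
Definition aff_code (R : rcfType) (m k : nat) (c : 'M[R]_m * 'rV[R]_m) : Prop :=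
  is_proj k c.1 /\ c.2 *m c.1 = 0.

Definition aff_points (R : rcfType) (m : nat) (c : 'M[R]_m * 'rV[R]_m)
  (x : 'rV[R]_m) : Prop := (x - c.2) *m c.1 = x - c.2.

Definition Gamma (R : rcfType) (n : nat) (A : 'M[R]_n) (a : 'rV[R]_n) (k : nat)
  (c : 'M[R]_n * 'rV[R]_n) : Prop :=
  aff_code k c /\
  forall y, aff_points c y <-> exists2 x, aff_points c x & aff_apply A a x = y.

Definition Sinv (R : rcfType) (m : nat) (B : 'M[R]_m) (k : nat) (P : 'M[R]_m) : Prop :=
  is_proj k P /\ forall x : 'rV[R]_m, x *m P = x -> (x *m B^T) *m P = x *m B^T.

Definition Gr (R : rcfType) (m j : nat) (c : 'M[R]_m * 'rV[R]_m) : Prop :=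
  aff_code j c.

Definition mdist (R : rcfType) (p q : nat) (M N : 'M[R]_(p, q)) : R :=
  \big[Num.max/0]_(i < p) \big[Num.max/0]_(j < q) `|M i j - N i j|.

Definition pdist (R : rcfType) (X Y : Type) (dX : X -> X -> R) (dY : Y -> Y -> R)
  (x y : X * Y) : R := Num.max (dX x.1 y.1) (dY x.2 y.2).

(* distance on a disjoint union tagged by nat: distinct summands are at
   distance 1 (this gives the disjoint-union topology). *)
Definition tdist (R : rcfType) (X : Type) (dX : X -> X -> R) (x y : nat * X) : R :=
  if x.1 == y.1 then dX x.2 y.2 else 1.

Definition cont_on (R : rcfType) (X Y : Type) (dX : X -> X -> R) (dY : Y -> Y -> R)
  (D : X -> Prop) (F : X -> Y) : Prop :=
  forall x, D x -> forall e : R, 0 < e ->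
    exists2 del : R, 0 < del & forall y, D y -> dX x y < del -> dY (F x) (F y) < e.

Definition homeomorphic (R : rcfType) (X Y : Type) (dX : X -> X -> R)
  (dY : Y -> Y -> R) (D : X -> Prop) (E : Y -> Prop) : Prop :=
  exists (F : X -> Y) (G : Y -> X),
    [/\ (forall x, D x -> E (F x)), (forall y, E y -> D (G y)),
        (forall x, D x -> G (F x) = x), (forall y, E y -> F (G y) = y) &
        (cont_on dX dY D F /\ cont_on dY dX E G)].

(* The disjoint union  \bigsqcup_{k1 + k2 = k} S_phi(k1) x Gr_{k2 - d}(E^{r'}),
   elements tagged by k1; the summand is empty when k2 < d. *)
Definition union_set (R : rcfType) (m r' d k : nat) (phi : 'M[R]_m)
  (z : nat * ('M[R]_m * ('M[R]_r' * 'rV[R]_r'))) : Prop :=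
  [/\ (z.1 <= k)%N, Sinv phi z.1 z.2.1, (d <= k - z.1)%N &
      Gr (k - z.1 - d) z.2.2].

(* Main.v *)
(* An orthogonal matrix A splits along the eigenspaces of the symmetric matrix
   A + A^T; on the one for the eigenvalue 2 Re(lambda), A is a combination of the
   identity and an orthogonal complex structure. A subspace is A-invariant iff its
   orthogonal projection commutes with all these eigenprojections and complex
   structures, the eigenvalues themselves being irrelevant. Hence equality of
   Segre symbols yields an isometry U of ker(A - I)^perp onto R^(n-r) that matches
   the invariant subspaces of A with those of phi_R.

   After a translation by v the map is x |-> A x + a0 with a0 in ker(A - I), and
   q + W is invariant iff W is A-invariant and contains a0, and the foot point of
   q - v lies in ker(A - I). Splitting W along ker(A - I)^perp, the line of a0 and
   the rest of ker(A - I) gives maps in both directions that are affine in the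
   codes. *)
Require Import Defs.
From HB Require Import structures.
From mathcomp Require Import all_boot all_order all_algebra.
From mathcomp Require Import spectral complex.
From mathcomp Require Import ring lra zify.
Import Order.TTheory GRing.Theory Num.Theory.
Local Open Scope ring_scope.

Set Implicit Arguments. Unset Strict Implicit. Unset Printing Implicit Defensive.

(** * Symmetric matrices over a real closed field *)

(** Dimensions of projections are counted by traces: the trace of an idempotent is its rank, it is
    additive, it vanishes only for the zero orthogonal projection, and it is Lipschitz. The last
    point makes the tag of the disjoint union locally constant, as continuity requires. The Segre
    symbol forgets the eigenvalues and also which entry comes from -1. So A and phi_R need not be
    conjugate, and what is carried from one to the other is not the map but the set of symmetric
    matrices commuting with it. For this an isometry has to match only the kind (real or complex)
    and the rank of each eigenspace; the entry of -1 is recovered by counting dimensions, since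
    complex eigenspaces have even real rank. The spectral theorem for A + A^T over a real closed
    field R is taken from the Hermitian one over R[i]. *)

Lemma mxtrace_idem (F : fieldType) n (P : 'M[F]_n) :
  P *m P = P -> \tr P = (\rank P)%:R.
Proof.
move=> PP; have [C [Q [PCQ /row_fullP[L LC] /row_freeP[M QM]]]] : exists C Q,
    [/\ P = C *m Q, row_full C & row_free (Q : 'M_(\rank P, n))].
  by exists (col_base P), (row_base P); rewrite mulmx_base col_base_full row_base_free.
have CQ : C *m Q *m (C *m Q) = C *m Q by rewrite -PCQ.
(* One-sided inverses of the two full-rank factors cancel CQCQ = CQ to QC = 1; the trace is then
   cyclic. *)
have QC : Q *m C = 1%:M.
  have : L *m (C *m Q *m (C *m Q)) *m M = L *m (C *m Q) *m M by rewrite CQ.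
  by rewrite !mulmxA LC mul1mx -!mulmxA QM mulmx1.
by rewrite {1}PCQ mxtrace_mulC QC mxtrace1.
Qed.

Definition sproj (R : rcfType) n (P : 'M[R]_n) := P^T = P /\ P *m P = P.

Section Real.
Variable R : rcfType.

Lemma mul_trmx_ge0 n (x : 'rV[R]_n) : 0 <= (x *m x^T) 0 0.
Proof. by rewrite mxE sumr_ge0// => i _; rewrite mxE -expr2 sqr_ge0. Qed.

Lemma mul_trmx_eq0 n (x : 'rV[R]_n) : ((x *m x^T) 0 0 == 0) = (x == 0).
Proof.
apply/idP/eqP => [|->]; last by rewrite mul0mx mxE.
rewrite mxE psumr_eq0 => [/allP h|i _]; last by rewrite mxE -expr2 sqr_ge0.
apply/rowP => i; have := h i (mem_index_enum i).
by rewrite /= mxE -expr2 sqrf_eq0 mxE => /eqP.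
Qed.

Lemma row_mul_trmx p n (X : 'M[R]_(p, n)) i :
  (row i X *m (row i X)^T) 0 0 = (X *m X^T) i i.
Proof. by rewrite !mxE; apply: eq_bigr => j _; rewrite !mxE. Qed.

Lemma mulmx_trmx_eq0 p n (X : 'M[R]_(p, n)) : X *m X^T = 0 -> X = 0.
Proof.
move=> h; apply/row_matrixP => i; rewrite row0; apply/eqP.
by rewrite -mul_trmx_eq0 row_mul_trmx h mxE.
Qed.

Lemma tr_mulmx_trmx_ge0 p n (X : 'M[R]_(p, n)) : 0 <= \tr (X *m X^T).
Proof.
rewrite /mxtrace sumr_ge0// => i _; rewrite mxE sumr_ge0// => j _.
by rewrite mxE -expr2 sqr_ge0.
Qed.

Lemma tr_mulmx_trmx_eq0 p n (X : 'M[R]_(p, n)) : \tr (X *m X^T) = 0 -> X = 0.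
Proof.
move=> /eqP; rewrite psumr_eq0 => [/allP h|i _]; last first.
  by rewrite mxE sumr_ge0// => j _; rewrite mxE -expr2 sqr_ge0.
apply/row_matrixP => i; rewrite row0; apply/eqP.
rewrite -mul_trmx_eq0 row_mul_trmx.
exact: h (mem_index_enum i).
Qed.

(** Here [P = P *m P^T], so the trace is the sum of the squares of the entries. *)
Lemma sproj_tr_eq0 n (P : 'M[R]_n) : sproj P -> \tr P = 0 -> P = 0.
Proof. by move=> [Pt PP] h; apply: tr_mulmx_trmx_eq0; rewrite Pt PP. Qed.

Lemma sproj0 n : sproj (0 : 'M[R]_n).
Proof. by split; rewrite ?trmx0 ?mul0mx. Qed.

Lemma sproj1 n : sproj (1%:M : 'M[R]_n).
Proof. by split; rewrite ?trmx1 ?mul1mx. Qed.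

Lemma sprojB n (P Q : 'M[R]_n) : sproj P -> sproj Q -> P *m Q = Q ->
  sproj (P - Q).
Proof.
move=> [Pt PP] [Qt QQ] PQ.
have QP : Q *m P = Q by rewrite -[in RHS]Qt -[in RHS]PQ trmx_mul Qt Pt.
split; first by rewrite linearB /= Pt Qt.
by rewrite mulmxBl !mulmxBr PP PQ QP QQ subrr subr0.
Qed.

Lemma mulmx_0sym n (P Q : 'M[R]_n) : P^T = P -> Q^T = Q -> P *m Q = 0 -> Q *m P = 0.
Proof. by move=> Pt Qt h; rewrite -Pt -Qt -trmx_mul h trmx0. Qed.

Lemma sprojD n (P Q : 'M[R]_n) : sproj P -> sproj Q -> P *m Q = 0 ->
  sproj (P + Q).
Proof.
move=> [Pt PP] [Qt QQ] PQ; have QP := mulmx_0sym Pt Qt PQ.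
split; first by rewrite linearD /= Pt Qt.
by rewrite mulmxDl !mulmxDr PP PQ QP QQ addr0 add0r.
Qed.

Lemma mulmx_sum_notin (I : eqType) n (e : I -> 'M[R]_n) (r : seq I) k :
  (forall k l, k != l -> e k *m e l = 0) -> k \notin r ->
  e k *m \sum_(l <- r) e l = 0.
Proof.
move=> orth kr; rewrite mulmx_sumr big_seq big1// => l lr; apply: orth.
by apply: contraNneq kr => ->.
Qed.

Lemma sproj_sum_orth (I : eqType) n (e : I -> 'M[R]_n) (r : seq I) :
  (forall k, sproj (e k)) -> (forall k l, k != l -> e k *m e l = 0) ->
  uniq r -> sproj (\sum_(k <- r) e k).
Proof.
move=> sp orth; elim: r => [|k r IH] /=; first by rewrite big_nil => _; exact: sproj0.
move=> /andP[kr /IH h]; rewrite big_cons; apply: sprojD => //.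
exact: mulmx_sum_notin.
Qed.

(** The monic polynomial with root list [mu], evaluated at [S]. *)
Definition shift_prod n (S : 'M[R]_n) (mu : seq R) : 'M[R]_n :=
  foldr (fun nu M => (S - nu%:M) *m M) 1%:M mu.

Lemma shift_prod_comm n (S : 'M[R]_n) mu :
  S *m shift_prod S mu = shift_prod S mu *m S.
Proof.
elim: mu => [|nu mu IH] /=; first by rewrite mul1mx mulmx1.
have SN : S *m (S - nu%:M) = (S - nu%:M) *m S.
  by rewrite mulmxBr mulmxBl scalar_mxC.
by rewrite mulmxA SN -!mulmxA IH.
Qed.

Lemma shift_prod_sym n (S : 'M[R]_n) mu : S^T = S ->
  (shift_prod S mu)^T = shift_prod S mu.
Proof.
move=> St; elim: mu => [|nu mu IH] /=; first by rewrite trmx1.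
rewrite trmx_mul IH linearB /= St tr_scalar_mx mulmxBr mulmxBl.
by rewrite shift_prod_comm scalar_mxC.
Qed.

Lemma shift_prod_eigen n (S M : 'M[R]_n) nu mu :
  S *m M = nu *: M ->
  shift_prod S mu *m M = (\prod_(k <- mu) (nu - k)) *: M.
Proof.
move=> SM; elim: mu => [|k mu IH] /=.
  by rewrite big_nil scale1r mul1mx.
rewrite -mulmxA IH -scalemxAr mulmxBl SM mul_scalar_mx -scalerBl scalerA.
by rewrite big_cons mulrC.
Qed.

(** Lagrange interpolation, one root at a time. [Q] projects onto the part of the space not yet
    split; it is arbitrary so that the induction can continue with [Q - E] once the eigenprojection
    [E] of the first root is removed. *)
Lemma spectral_of_annihilated n (S Q : 'M[R]_n) mu :
  S^T = S -> sproj Q -> S *m Q = Q *m S -> uniq mu ->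
  Q *m shift_prod S mu = 0 ->
  exists e : R -> 'M[R]_n,
    [/\ forall k, sproj (e k), forall k, Q *m e k = e k,
        forall k, S *m e k = k *: e k,
        forall k, k \notin mu -> e k = 0
      & \sum_(k <- mu) e k = Q].
Proof.
move=> St; elim: mu Q => [|nu mu IH] Q [Qt QQ] SQ /=.
  rewrite mulmx1 => _ ->; exists (fun=> 0); split=> // *; rewrite ?big_nil//.
  - exact: sproj0.
  - by rewrite mulmx0.
  - by rewrite mulmx0 scaler0.
move=> /andP[nu_mu mu_u]; set M := shift_prod S mu => QM.
have MS : S *m M = M *m S by apply: shift_prod_comm.
have Mt : M^T = M by apply: shift_prod_sym.
have MQ : M *m Q = Q *m M.
  rewrite /M; elim: (mu) => [|k l IHl] /=; first by rewrite mul1mx mulmx1.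
  rewrite -mulmxA IHl !mulmxA mulmxBl mulmxBr SQ.
  by rewrite mul_scalar_mx mul_mx_scalar.
have SQM : S *m (Q *m M) = nu *: (Q *m M).
  apply/eqP; rewrite -subr_eq0 -mul_scalar_mx -mulmxBl mulmxA.
  by rewrite mulmxBl SQ mul_scalar_mx -mul_mx_scalar -mulmxBr -mulmxA QM.
(* The value at [nu] of the polynomial with the remaining roots, nonzero as the roots are distinct.
   [M] multiplies [Q *m M] by it, so dividing by it makes [E] idempotent. *)
pose c := \prod_(k <- mu) (nu - k).
have c0 : c != 0.
  rewrite /c prodf_seq_neq0; apply/allP => k kmu /=.
  by rewrite subr_eq0; apply: contraNneq nu_mu => ->.
pose E := c^-1 *: (Q *m M).
have ME : M *m (Q *m M) = c *: (Q *m M) by exact: shift_prod_eigen SQM.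
have spE : sproj E.
  split; first by rewrite linearZ /= trmx_mul Mt Qt MQ.
  rewrite -scalemxAl -scalemxAr -mulmxA ME -scalemxAr mulmxA QQ !scalerA.
  by rewrite mulVf// mulr1.
have QE : Q *m E = E by rewrite -scalemxAr mulmxA QQ.
have SE : S *m E = nu *: E by rewrite -scalemxAr SQM !scalerA mulrC.
have ES : E *m S = nu *: E.
  by rewrite -[E in LHS](proj1 spE) -St -trmx_mul SE linearZ /= (proj1 spE).
have [||||e [e1 e2 e3 e4 e5]] := IH (Q - E).
- exact: sprojB.
- by rewrite mulmxBr mulmxBl SE ES SQ.
- by [].
- have -> : (Q - E) *m shift_prod S mu = Q *m M - E *m M by rewrite mulmxBl.
  by rewrite -scalemxAl -MQ -mulmxA ME scalerA mulVf// scale1r -MQ subrr.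
exists (fun k => if k == nu then E else e k); split=> [k|k|k|k|].
- by case: eqP.
- case: eqP => // _; rewrite -[in LHS]e2 mulmxA mulmxBr QQ QE.
  by rewrite e2.
- by case: eqP => [->|].
- by rewrite inE negb_or => /andP[/negPf-> /e4].
- rewrite big_cons eqxx -[RHS](subrK E) addrC -e5; congr (_ + _).
  apply: eq_big_seq => k kmu; case: eqP => // knu.
  by rewrite -knu kmu in nu_mu.
Qed.

(** Over [R[i]] the matrix is Hermitian, hence unitarily diagonalizable with real eigenvalues. Each
    eigenvalue is needed only once to kill a diagonal matrix, which allows [undup]; the embedding of
    [R] is injective, so the product already vanishes over [R]. *)
Lemma shift_prod_annihilates n (S : 'M[R]_n) : S^T = S ->
  exists2 mu, uniq mu & shift_prod S mu = 0.
Proof.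
move=> St; pose f := real_complex R; pose SC := map_mx f S.
have SCh : SC \is hermsymmx.
  apply: realsym_hermsym.
    apply/is_hermitianmxP; rewrite expr0 scale1r.
    rewrite map_mx_id//.
    by rewrite /SC map_trmx St.
  by apply/mxOverP => i j; rewrite mxE; apply/complex_realP; exists (S i j).
have /mxOverP dreal := hermitian_spectral_diag_real SCh.
have /orthomx_spectralP SCE := hermitian_normalmx SCh.
set P := spectralmx SC in SCE; set d := spectral_diag SC in SCE dreal.
have Pu : P \in unitmx by apply: spectral_unit.
pose mu := undup [seq complex.Re (d 0 i) | i <- enum 'I_n].
exists mu; first exact: undup_uniq.
apply: (@map_mx_inj _ _ f); rewrite map_mx0.
have prodE l : map_mx f (shift_prod S l) =
    invmx P *m diag_mx (\row_i \prod_(k <- l) (d 0 i - f k)) *m P.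
  elim: l => [|k l IH] /=.
    rewrite map_mx1 (_ : \row_i _ = const_mx 1).
      by rewrite diag_const_mx mulmx1 mulVmx.
    by apply/rowP => i; rewrite !mxE big_nil.
  rewrite map_mxM IH map_mxB map_scalar_mx -/SC SCE.
  have -> : (f k)%:M = invmx P *m (f k)%:M *m P.
    by rewrite mul_mx_scalar -scalemxAl mulVmx// scalemx1.
  rewrite -mulmxBl -mulmxBr !mulmxA (mulmxK Pu); congr (_ *m _).
  rewrite -!mulmxA; congr (_ *m _); rewrite -diag_const_mx -linearB /=.
  rewrite mulmx_diag; congr diag_mx; apply/rowP => i.
  by rewrite !mxE big_cons.
rewrite prodE (_ : \row_i _ = 0) ?linear0 ?mulmx0 ?mul0mx//.
apply/rowP => i; rewrite !mxE; apply/eqP; rewrite prodf_seq_eq0.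
apply/hasP; exists (complex.Re (d 0 i)).
  by rewrite mem_undup; apply: map_f; rewrite mem_enum.
have -> : f (complex.Re (d 0 i)) = d 0 i by apply: RRe_real.
by rewrite /= subrr.
Qed.

Lemma symmetric_spectral n (S : 'M[R]_n) : S^T = S ->
  exists (mu : seq R) (e : R -> 'M[R]_n),
    [/\ uniq mu, forall k, sproj (e k), forall k, S *m e k = k *: e k,
        forall k, k \notin mu -> e k = 0
      & \sum_(k <- mu) e k = 1%:M].
Proof.
move=> St; have [mu mu_u h] := shift_prod_annihilates St.
have [||e [e1 e2 e3 e4 e5]] :=
  spectral_of_annihilated St (sproj1 n) _ mu_u.
- by rewrite mulmx1 mul1mx.
- by rewrite mul1mx.
by exists mu, e.
Qed.

End Real.

(** * Isometries between complex structures *)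

(* [J] is a complex structure on the range of [E] if [b] is true, and 0 if [b] is
   false; this treats complex and real eigenspaces at once. *)
Definition block (R : rcfType) (b : bool) n (E J : 'M[R]_n) :=
  [/\ sproj E, J^T = - J & J *m J = - (b%:R *: E)].

Section Blocks.
Variable R : rcfType.

(** The Gram matrix of [E *m T - T] expands to zero once [T *m T^T] is replaced by [E]. *)
Lemma range_mulmxl p n (T : 'M[R]_(p, n)) E :
  T *m T^T = E -> E *m E = E -> E *m T = T.
Proof.
move=> TT EE; apply/eqP; rewrite -subr_eq0; apply/eqP.
have Et : E^T = E by rewrite -TT trmx_mul trmxK.
apply: mulmx_trmx_eq0; rewrite linearB /= trmx_mul Et mulmxBl !mulmxBr.
by rewrite !mulmxA TT -[E *m T *m _]mulmxA TT !EE !subrr.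
Qed.

Lemma range_mulmxr p n (T : 'M[R]_(p, n)) E :
  T^T *m T = E -> E *m E = E -> T *m E = T.
Proof.
move=> TT EE; apply: trmx_inj; rewrite trmx_mul.
have -> : E^T = E by rewrite -TT trmx_mul trmxK.
by apply: range_mulmxl => //; rewrite trmxK.
Qed.

(** That [J] lives on the range of [E] is not part of [block]; it follows from [J *m J^T = b E],
    which makes the Gram matrix of [E *m J - J] vanish. *)
Lemma block_mulEJ b n (E J : 'M[R]_n) : block b E J -> E *m J = J.
Proof.
case=> -[Et EE] Jt JJ; apply/eqP; rewrite -subr_eq0; apply/eqP.
apply: mulmx_trmx_eq0.
rewrite linearB /= trmx_mul Jt Et mulmxBl !mulmxBr !mulNmx !mulmxN !mulmxA.
rewrite -[E *m J *m J]mulmxA JJ.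
by rewrite !(mulNmx, mulmxN) -?scalemxAr -?scalemxAl !EE !opprK ?EE ?addrN ?subrr.
Qed.

Lemma block_mulJE b n (E J : 'M[R]_n) : block b E J -> J *m E = J.
Proof.
move=> bEJ; have [[Et EE] Jt JJ] := bEJ.
apply: trmx_inj; rewrite trmx_mul Et Jt mulmxN.
by rewrite (block_mulEJ bEJ).
Qed.

Lemma block_false_eq0 n (E J : 'M[R]_n) : block false E J -> J = 0.
Proof.
case=> _ Jt JJ; apply: mulmx_trmx_eq0.
by rewrite Jt mulmxN JJ scale0r !oppr0.
Qed.

Lemma block_false n (E : 'M[R]_n) : sproj E -> block false E 0.
Proof. by split; rewrite ?trmx0 ?oppr0 ?mulmx0 ?scale0r ?oppr0. Qed.

Lemma sproj_unit_vector n (E : 'M[R]_n) : sproj E -> E != 0 ->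
  exists2 x : 'rV[R]_n, x *m x^T = 1%:M & x *m E = x.
Proof.
move=> [Et EE] E0.
have /existsP[i yi] : [exists i, row i E != 0].
  apply: contraR E0 => /existsPn h; apply/eqP/row_matrixP => i; rewrite row0.
  by apply/eqP; have := h i; rewrite negbK.
set y := row i E in yi.
have c0 : 0 < (y *m y^T) 0 0 by rewrite lt_def mul_trmx_eq0 yi mul_trmx_ge0.
set c := (y *m y^T) 0 0 in c0.
exists ((Num.sqrt c)^-1 *: y); last first.
  by rewrite -scalemxAl /y -row_mul EE.
rewrite linearZ /= -scalemxAl -scalemxAr scalerA -invfM -expr2 sqr_sqrtr ?ltW//.
rewrite [y *m _]mx11_scalar -/c scale_scalar_mx mulVf//.
exact: lt0r_neq0.
Qed.

(** Splits off the smallest [J]-stable piece: the line of a unit vector [x] in the real case, where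
    [y = 0], and the plane of [x] and [x *m J] in the complex case. The factors [b%:R] let one
    computation serve both, and the remainder is again a block, ready for induction. *)
Lemma block_line b n (E J : 'M[R]_n) : block b E J -> E != 0 ->
  exists x y : 'rV[R]_n, let F := x^T *m x + y^T *m y in
    [/\ [/\ x *m x^T = 1%:M, y *m y^T = b%:R%:M, x *m y^T = 0 & y *m x^T = 0],
        [/\ x *m J = y, y *m J = - (b%:R *: x) & b%:R *: y = y],
        [/\ x *m (E - F) = 0, y *m (E - F) = 0 & F *m J = J *m F],
        \tr F = 1 + b%:R
      & block b (E - F) (J - J *m F)].
Proof.
move=> bEJ E0; have [[Et EE] Jt JJ] := bEJ.
have [x x1 xE] := sproj_unit_vector (conj Et EE) E0.
have [y yxJ] : exists y, x *m J = y by exists (x *m J).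
exists x, y => F.
have yy : y *m y^T = b%:R%:M.
  rewrite -yxJ trmx_mul Jt mulmxA -[x *m J *m _]mulmxA mulmxN JJ opprK.
  by rewrite -scalemxAr xE -scalemxAl x1 scalemx1.
have xy : x *m y^T = 0.
  (* [x *m J *m x^T] is a 1 by 1 matrix equal to minus its transpose, hence zero. *)
  have h : x *m y^T = - (x *m y^T).
    rewrite -[in LHS]yxJ trmx_mul Jt mulNmx mulmxN mulmxA yxJ.
    have -> : y *m x^T = (x *m y^T)^T by rewrite trmx_mul trmxK.
    by rewrite [x *m y^T]mx11_scalar tr_scalar_mx.
  apply/eqP; move/eqP: h; rewrite -addr_eq0 -mulr2n -scaler_nat scaler_eq0.
  by rewrite pnatr_eq0.
have yx : y *m x^T = 0 by rewrite -[LHS]trmxK trmx_mul trmxK xy trmx0.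
have yJ : y *m J = - (b%:R *: x) by rewrite -yxJ -mulmxA JJ mulmxN -scalemxAr xE.
have yE : y *m E = y by rewrite -yxJ -mulmxA (block_mulJE bEJ).
have by_ : b%:R *: y = y.
  case: (b) bEJ => [_|/block_false_eq0 J0]; first by rewrite scale1r.
  by rewrite -yxJ J0 mulmx0 scaler0.
have xF : x *m F = x by rewrite mulmxDr !mulmxA x1 xy mul1mx mul0mx addr0.
have yF : y *m F = y.
  by rewrite mulmxDr !mulmxA yx yy mul_scalar_mx mul0mx add0r.
have FJ : F *m J = x^T *m y - y^T *m x.
  rewrite mulmxDl -!mulmxA yxJ yJ mulmxN -scalemxAr scalemxAl.
  by rewrite -[b%:R *: y^T]linearZ /= by_.
have JF : J *m F = x^T *m y - y^T *m x.
  have := congr1 trmx FJ; rewrite trmx_mul Jt mulNmx linearB /= !trmx_mul !trmxK.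
  rewrite (_ : F^T = F); last by rewrite linearD /= !trmx_mul !trmxK.
  by move/eqP; rewrite eqr_oppLR opprB => /eqP.
have Ft : F^T = F by rewrite linearD /= !trmx_mul !trmxK.
have FF : F *m F = F by rewrite {1}/F mulmxDl -!mulmxA xF yF.
have FE : F *m E = F by rewrite {1}/F mulmxDl -!mulmxA xE yE.
have EF : E *m F = F by rewrite -[in RHS]Ft -[in RHS]FE trmx_mul Et Ft.
split=> //.
- by split; rewrite ?mulmxBr ?xE ?xF ?yE ?yF ?subrr// FJ JF.
- rewrite linearD /= mxtrace_mulC x1 [X in _ + X]mxtrace_mulC yy.
  by rewrite !mxtrace_scalar.
split; first exact: sprojB.
- rewrite linearB /= trmx_mul Jt Ft mulmxN FJ -JF.
  by rewrite opprB opprK addrC.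
- have JFJ : J *m F *m J = J *m J *m F by rewrite -mulmxA FJ -JF mulmxA.
  rewrite mulmxBl !mulmxBr !mulmxA JFJ -[_ *m F *m F]mulmxA FF subrr subr0.
  by rewrite JJ mulNmx -scalemxAl EF scalerBr opprB opprK addrC.
Qed.

(** Induction on the rank: [T0] matches the pieces given by [block_line], [T1] matches the
    remainders. [T0] lives on [F], [T1] on [E - F], so all cross terms vanish. Equality of
    dimensions is stated by traces because they subtract. *)
Lemma block_intertwine b n m (E J : 'M[R]_n) (E' J' : 'M[R]_m) :
  block b E J -> block b E' J' -> \tr E = \tr E' ->
  exists T : 'M[R]_(m, n),
    [/\ T *m T^T = E', T^T *m T = E & T *m J = J' *m T].
Proof.
have [N] := ubnP (\rank E); elim: N E J E' J' => // N IH E J E' J' rE bEJ bEJ' trE.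
have [E0|E0] := eqVneq E 0.
  have E'0 : E' = 0.
    by apply: sproj_tr_eq0; [case: bEJ' | rewrite -trE E0 mxtrace0].
  exists 0; rewrite !mul0mx mulmx0 E0 E'0; split=> //.
  by rewrite mulmx0.
have E'0 : E' != 0.
  apply: contraNneq E0 => E'0; apply/eqP.
  by apply: sproj_tr_eq0; [case: bEJ | rewrite trE E'0 mxtrace0].
have [x [y]] := block_line bEJ E0.
set F := x^T *m x + y^T *m y => -[[xx yy xy yx] [xJ yJ by1] [xE1 yE1 FJ] trF bl1].
have [x' [y']] := block_line bEJ' E'0.
set F' := x'^T *m x' + y'^T *m y' => -[[xx' yy' xy' yx'] [xJ' yJ' by1'] [xE1' yE1' FJ'] trF' bl1'].
have [||T1 [T1a T1b T1c]] := IH _ _ _ _ _ bl1 bl1'.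
- rewrite -ltnS; apply: leq_trans rE.
  rewrite ltnS -(ltr_nat R) -!mxtrace_idem; [|by case: bEJ => -[]|by case: bl1 => -[]].
  by rewrite linearB /= trF ltrBlDr ltrDl ltr_pwDl// ler0n.
- by rewrite !linearB /= trE trF trF'.
have [[E1t E1E1] J1t J1J1] := bl1.
have [[E1t' E1E1'] J1t' J1J1'] := bl1'.
have T1l := range_mulmxl T1a E1E1'.
have T1r := range_mulmxr T1b E1E1.
have [T0 T0d] : exists T0, T0 = x'^T *m x + y'^T *m y by eexists.
have T0t : T0^T = x^T *m x' + y^T *m y'.
  by rewrite T0d linearD /= !trmx_mul !trmxK.
have T0E1 : T0 *m (E - F) = 0.
  by rewrite T0d mulmxDl -!mulmxA xE1 yE1 !mulmx0 addr0.
have T0E1' : T0^T *m (E' - F') = 0.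
  by rewrite T0t mulmxDl -!mulmxA xE1' yE1' !mulmx0 addr0.
have T0T1 : T0 *m T1^T = 0.
  by rewrite -T1r trmx_mul E1t mulmxA T0E1 mul0mx.
have T0T1' : T0^T *m T1 = 0.
  by rewrite -T1l mulmxA T0E1' mul0mx.
have T1T0 : T1 *m T0^T = 0 by rewrite -[LHS]trmxK trmx_mul trmxK T0T1 trmx0.
have T1T0' : T1^T *m T0 = 0.
  by rewrite -[LHS]trmxK trmx_mul trmxK T0T1' trmx0.
have T0T0 : T0 *m T0^T = F'.
  rewrite T0t T0d mulmxDl !mulmxDr !mulmxA -!(mulmxA _ x) -!(mulmxA _ y).
  rewrite xx xy yx yy !mulmx0 !mul0mx addr0 add0r mulmx1 mul_mx_scalar.
  by rewrite -scalemxAl scalemxAr by1'.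
have T0T0' : T0^T *m T0 = F.
  rewrite T0t T0d mulmxDl !mulmxDr !mulmxA -!(mulmxA _ x') -!(mulmxA _ y').
  rewrite xx' xy' yx' yy' !mulmx0 !mul0mx addr0 add0r mulmx1 mul_mx_scalar.
  by rewrite -scalemxAl scalemxAr by1.
have TD : (T0 + T1)^T = T0^T + T1^T by rewrite linearD.
exists (T0 + T1); split.
- by rewrite TD mulmxDl !mulmxDr T0T0 T0T1 T1T0 T1a addr0 add0r addrC subrK.
- by rewrite TD mulmxDl !mulmxDr T0T0' T0T1' T1T0' T1b addr0 add0r addrC subrK.
have J't : J' = - J'^T by case: bEJ' => _ -> _; rewrite opprK.
rewrite mulmxDl mulmxDr; congr (_ + _).
  rewrite T0d mulmxDl mulmxDr -!mulmxA xJ yJ mulmxN.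
  have -> : J' *m (x'^T *m x) = - (y'^T *m x).
    by rewrite J't mulNmx mulmxA -trmx_mul xJ'.
  have -> : J' *m (y'^T *m y) = x'^T *m y.
    rewrite J't mulNmx mulmxA -trmx_mul yJ' linearN /= mulNmx opprK.
    by rewrite linearZ /= -scalemxAl scalemxAr by1.
  rewrite addrC; congr (- _ + _).
  by rewrite -scalemxAr scalemxAl -[_ *: y'^T]linearZ /= by1'.
(* [T1] factors through [E - F], where [J] and its restriction [J - J *m F] agree. *)
have -> : T1 *m J = T1 *m (J - J *m F).
  by rewrite -[T1 in LHS]T1r -mulmxA mulmxBl FJ (block_mulEJ bEJ).
have -> : J' *m T1 = (J' - J' *m F') *m T1.
  by rewrite -[T1 in LHS]T1l mulmxA mulmxBr (block_mulJE bEJ').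
exact: T1c.
Qed.

End Blocks.

(** * Spectral data of an orthogonal matrix *)

Section Spec.
Variable R : rcfType.

Lemma orth_mx_tr n (B : 'M[R]_n) : orth_mx B -> B^T *m B = 1%:M.
Proof. exact: mulmx1C. Qed.

Lemma sproj_rank_compl n (P : 'M[R]_n) : sproj P ->
  kerdim P = \rank (1%:M - P).
Proof.
move=> spP; have [Pt PP] := spP.
have [_ QQ] := sprojB (sproj1 R n) spP (mul1mx _).
apply/eqP; rewrite -(eqr_nat R) -mxtrace_idem// linearB /= mxtrace1.
by rewrite (mxtrace_idem PP) natrB ?rank_leq_row.
Qed.

Lemma mxrank_gram p n (M : 'M[R]_(p, n)) : \rank (M^T *m M) = \rank M.
Proof.
apply/eqP; rewrite eqn_leq mxrankM_maxr /=.
have h : (kermx (M^T *m M) <= kermx M^T)%MS.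
  apply/sub_kermxP; apply: mulmx_trmx_eq0.
  by rewrite trmx_mul trmxK mulmxA -[_ *m _ *m M]mulmxA mulmx_ker mul0mx.
have := mxrankS h; rewrite !mxrank_ker mxrank_tr => h2.
rewrite leqNgt; apply/negP => h3.
have := ltn_sub2l (leq_trans h3 (rank_leq_col M)) h3.
by rewrite ltnNge h2.
Qed.

(* The eigenvalues k of B + B^T index the conjugate pairs of eigenvalues of [B]:
   on the range of [e k], [B] acts as k/2 + i sqrt (1 - k^2/4) with [J k] as i. *)
Record spectral_data n (B : 'M[R]_n) (mu : seq R) (e J : R -> 'M[R]_n) := SpectralData {
  sd_uniq : uniq mu;
  sd_block : forall k, block (k ^+ 2 != 4) (e k) (J k);
  sd_out : forall k, k \notin mu -> e k = 0;
  sd_sum : \sum_(k <- mu) e k = 1%:M;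
  sd_orth : forall k l, k != l -> e k *m e l = 0;
  sd_bound : forall k, e k != 0 -> k ^+ 2 <= 4;
  sd_sym : forall k, (B + B^T) *m e k = k *: e k;
  sd_act : forall k, B *m e k = (k / 2) *: e k + Num.sqrt (1 - k ^+ 2 / 4) *: J k;
  sd_comm : forall P, P^T = P -> P *m B = B *m P ->
    forall k, P *m e k = e k *m P /\ P *m J k = J k *m P }.

(** The symmetric matrix [B + B^T] commutes with [B], so its eigenprojections reduce [B]; on each of
    them the skew part of [B], once normalized, is the complex structure. *)
Lemma orth_spectral n (B : 'M[R]_n) : orth_mx B ->
  exists mu e J, spectral_data B mu e J.
Proof.
move=> oB; have oB' := orth_mx_tr oB.
set S := B + B^T.
have St : S^T = S by rewrite linearD /= trmxK addrC.
have [mu [e [mu_u spe Se e0 esum]]] := symmetric_spectral St.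
have et k : (e k)^T = e k by case: (spe k).
have ee k : e k *m e k = e k by case: (spe k).
have eS k : e k *m S = k *: e k.
  by rewrite -[in LHS](et k) -St -trmx_mul Se linearZ /= et.
have orth k l : k != l -> e k *m e l = 0.
  move=> kl; have : (k - l) *: (e k *m e l) = 0.
    by rewrite scalerBl scalemxAl -eS -mulmxA Se -scalemxAr subrr.
  by move/eqP; rewrite scaler_eq0 subr_eq0 (negPf kl) => /eqP.
have comm P : P *m S = S *m P -> forall k, P *m e k = e k *m P.
  move=> PS k.
  have offd i j : i != j -> e i *m P *m e j = 0.
    move=> ij; have : (i - j) *: (e i *m P *m e j) = 0.
      rewrite scalerBl !scalemxAl -eS -[e i *m S *m P]mulmxA -PS.
      by rewrite mulmxA -[_ *m S *m _]mulmxA Se -!scalemxAl -scalemxAr subrr.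
    by move/eqP; rewrite scaler_eq0 subr_eq0 (negPf ij) => /eqP.
  have l1 : P *m e k = e k *m P *m e k.
    have [kmu|/e0->] := boolP (k \in mu); last by rewrite !mulmx0.
    rewrite -[P in LHS]mul1mx -esum !mulmx_suml.
    rewrite (bigD1_seq k)//= big1 ?addr0// => i ik; exact: offd.
  have l2 : e k *m P = e k *m P *m e k.
    have [kmu|/e0->] := boolP (k \in mu); last by rewrite !mul0mx.
    rewrite -[LHS]mulmx1 -esum mulmx_sumr (bigD1_seq k)//= big1 ?addr0// => i ik.
    by apply: offd; rewrite eq_sym.
  by rewrite l1 -l2.
have BS : B *m S = S *m B by rewrite mulmxDr mulmxDl oB oB'.
have Be k : B *m e k = e k *m B by apply: comm.
have Bte k : B^T *m e k = e k *m B^T.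
  by have := congr1 trmx (Be k); rewrite !trmx_mul et => ->.
(* As [B^T] is the inverse of [B], on the range of [e k] one has B^2 - k B + 1 = 0. Completing the
   square leaves [X k], skew with square k^2/4 - 1. *)
pose X k := B *m e k - (k / 2) *: e k.
have Xt k : (X k)^T = - X k.
  rewrite /X linearB linearZ /= trmx_mul et -Bte opprB.
  have -> : B^T *m e k = k *: e k - B *m e k.
    by rewrite -Se mulmxDl [RHS]addrC addKr.
  by rewrite addrAC -scalerBl; congr (_ *: _ - _); field.
have XX k : X k *m X k = (k ^+ 2 / 4 - 1) *: e k.
  have XE : X k = (B - (k / 2)%:M) *m e k by rewrite mulmxBl mul_scalar_mx.
  rewrite {1}XE -mulmxA.
  have -> : e k *m X k = X k.
    by rewrite /X mulmxBr mulmxA -Be -mulmxA ee -scalemxAr ee.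
  rewrite XE mulmxA.
  have -> : (B - (k / 2)%:M) *m (B - (k / 2)%:M) =
     B *m S - k *: B + (k ^+ 2 / 4 - 1)%:M.
    rewrite mulmxBl !mulmxBr mul_mx_scalar !mul_scalar_mx mulmxDr oB.
    move: (B *m B) => Y; apply/matrixP => i j; rewrite !mxE.
    by case: (i == j); rewrite ?mulr1n ?mulr0n; field.
  rewrite mulmxDl mulmxBl -mulmxA Se -scalemxAr -scalemxAl subrr add0r.
  by rewrite mul_scalar_mx.
have bound k : e k != 0 -> k ^+ 2 <= 4.
  (* The trace of [X k *m (X k)^T] is (1 - k^2/4) times that of [e k]; the former is nonnegative,
     the latter positive. *)
  move=> ek0; have := tr_mulmx_trmx_ge0 (X k).
  rewrite Xt mulmxN XX -scaleNr linearZ /=.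
  have : 0 < \tr (e k).
    have := tr_mulmx_trmx_ge0 (e k); rewrite et ee lt_def => ->; rewrite andbT.
    by apply: contraNneq ek0 => /(sproj_tr_eq0 (spe k)) ->.
  move=> tr0; rewrite pmulr_lge0//; lra.
pose be (k : R) := Num.sqrt (1 - k ^+ 2 / 4).
(* If k^2 = 4 then [be k = 0], and the convention 0^-1 = 0 gives [J k = 0]. *)
exists mu, e, (fun k => (be k)^-1 *: X k).
have beX k : k ^+ 2 = 4 -> be k = 0 /\ X k = 0.
  move=> k4; rewrite /be k4 divff ?subrr ?sqrtr0 ?pnatr_eq0//; split=> //.
  apply: mulmx_trmx_eq0; rewrite Xt mulmxN XX k4 divff ?pnatr_eq0//.
  by rewrite subrr scale0r oppr0.
split=> //.
- move=> k; split; first exact: spe.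
    by rewrite linearZ /= Xt scalerN.
  rewrite -scalemxAl -scalemxAr scalerA XX.
  have [k4|k4] := eqVneq (k ^+ 2) 4.
    by rewrite /= k4 divff ?pnatr_eq0// subrr !scale0r scaler0 oppr0.
  have [->|ek0] := eqVneq (e k) 0; first by rewrite !scaler0 oppr0.
  rewrite scale1r scalerA -invfM -expr2 sqr_sqrtr; last by have := bound k ek0; lra.
  rewrite -scaleN1r; congr (_ *: _).
  by field; apply: contra_neq k4; lra.
- move=> k.
  have [k4|k4] := eqVneq (k ^+ 2) 4.
    have [_ X0] := beX k k4; rewrite X0 !scaler0 addr0.
    by apply/eqP; rewrite -subr_eq0 -/(X k) X0.
  have [E0|ek0] := eqVneq (e k) 0.
    by rewrite /X E0 mulmx0 !scaler0 subr0 !scaler0 addr0.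
  rewrite scalerA divff ?scale1r; first by rewrite /X addrC subrK.
  rewrite lt0r_neq0// sqrtr_gt0; have := bound k ek0; rewrite le_eqVlt (negPf k4) /=.
  lra.
- move=> P Pt PB k.
  have PBt : P *m B^T = B^T *m P.
    by have := congr1 trmx PB; rewrite !trmx_mul Pt.
  have Pe : P *m e k = e k *m P.
    by apply: comm; rewrite mulmxDr mulmxDl PB PBt.
  split=> //; rewrite -scalemxAr -scalemxAl; congr (_ *: _).
  rewrite /X mulmxBr mulmxBl mulmxA PB -!mulmxA Pe.
  by rewrite -scalemxAr -scalemxAl Pe.
Qed.

(** * Kernel dimensions read off the spectral data *)

Section Data.
Variables (n : nat) (B : 'M[R]_n) (mu : seq R) (e J : R -> 'M[R]_n).
Hypothesis oB : orth_mx B.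
Hypothesis sd : spectral_data B mu e J.

Lemma sd_sproj k : sproj (e k).
Proof. by case: (sd_block sd k). Qed.

Lemma sproj_sum (r : seq R) : uniq r -> sproj (\sum_(k <- r) e k).
Proof. exact: sproj_sum_orth sd_sproj (sd_orth sd). Qed.

Lemma mulmx_sum_sd (f : R -> R) k : k \in mu ->
  (\sum_(l <- mu) f l *: e l) *m e k = f k *: e k.
Proof.
move=> kmu; rewrite mulmx_suml (bigD1_seq k)//=; last exact: sd_uniq sd.
rewrite big1 ?addr0 => [|l lk].
  by rewrite -scalemxAl; case: (sd_sproj k) => _ ->.
by rewrite -scalemxAl (sd_orth sd)// scaler0.
Qed.

Lemma sd_expand p (M : 'M[R]_(p, n)) : M = \sum_(k <- mu) M *m e k.
Proof. by rewrite -mulmx_sumr (sd_sum sd) mulmx1. Qed.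

(** [M] has the rank of its Gram matrix [M^T *m M], which is diagonal in the eigenprojections; [Z']
    inverts it where [q] is nonzero, so that rank is the rank of [Q]. *)
Lemma kerdim_spectral (M : 'M[R]_n) (q : R -> R) :
  (forall k, e k != 0 -> M^T *m M *m e k = q k *: e k) ->
  kerdim M = \rank (\sum_(k <- mu | q k == 0) e k)%R.
Proof.
move=> h; have MM : M^T *m M = \sum_(k <- mu) q k *: e k.
  rewrite [LHS]sd_expand; apply: eq_bigr => k _.
  by have [->|/h//] := eqVneq (e k) 0; rewrite mulmx0 scaler0.
pose Z := \sum_(k <- mu) q k *: e k.
pose Z' := \sum_(k <- mu) (q k)^-1 *: e k.
pose Q := \sum_(k <- mu | q k != 0) e k.
have ZQ : Z' *m Z = Q.
  rewrite [LHS]sd_expand /Q [in RHS]big_mkcond /=.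
  apply: eq_big_seq => k kmu.
  rewrite -mulmxA mulmx_sum_sd// -scalemxAr mulmx_sum_sd// scalerA.
  by case: eqP => [->|/eqP k0]; rewrite ?mul0r ?scale0r// mulfV// scale1r.
have QZ : Z *m Q = Z.
  rewrite /Q mulmx_sumr [RHS]sd_expand [in LHS]big_mkcond /=.
  apply: eq_big_seq => k kmu; rewrite mulmx_sum_sd//.
  by case: eqP => //= ->; rewrite scale0r.
have rQ : \rank M = \rank Q.
  rewrite -mxrank_gram MM -/Z; apply/eqP; rewrite eqn_leq.
  by rewrite -{1}QZ mxrankM_maxr -ZQ mxrankM_maxr.
have spQ : sproj Q.
  by rewrite /Q -big_filter; apply/sproj_sum/filter_uniq; exact: sd_uniq sd.
rewrite /kerdim rQ -/(kerdim Q) sproj_rank_compl//; congr (\rank _).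
rewrite -(sd_sum sd) [in LHS](bigID (fun k => q k == 0)) /=; apply: addrK.
Qed.

Lemma kerdim_spectral1 (M : 'M[R]_n) (q : R -> R) k0 :
  (forall k, e k != 0 -> M^T *m M *m e k = q k *: e k) ->
  (forall k, e k != 0 -> (q k == 0) = (k == k0)) ->
  kerdim M = \rank (e k0).
Proof.
move=> h1 h2; rewrite (kerdim_spectral h1); congr (\rank _).
have [k0mu|k0mu] := boolP (k0 \in mu).
  rewrite big_mkcond (bigD1_seq k0)//=; last exact: sd_uniq sd.
  rewrite big1 ?addr0 => [|k kk0].
    by have [->|/h2->] := eqVneq (e k0) 0; rewrite ?if_same ?eqxx.
  by have [->|/h2->] := eqVneq (e k) 0; rewrite ?if_same ?(negPf kk0).
rewrite (sd_out sd k0mu) big_seq_cond big1// => k /andP[kmu].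
have [->//|/h2->/eqP kk0] := eqVneq (e k) 0.
by rewrite -kk0 kmu in k0mu.
Qed.

(** The Gram matrix of [B - 1%:M] is 2 - (B + B^T). *)
Lemma kerdimB1 : kerdim (B - 1%:M) = \rank (e 2).
Proof.
apply: (@kerdim_spectral1 _ (fun k => 2 - k)) => [k _|k _]; last first.
  by rewrite subr_eq0 eq_sym.
have -> : (B - 1%:M)^T = B^T - 1%:M by rewrite linearB /= trmx1.
rewrite mulmxBl !mulmxBr mulmx1 !mul1mx orth_mx_tr//.
rewrite scalerBl -(sd_sym sd) -mul_scalar_mx -mulmxBl; congr (_ *m _).
apply/matrixP => i j; rewrite !mxE.
by case: (i == j); rewrite ?mulr1n ?mulr0n; ring.
Qed.

Lemma kerdimD1 : kerdim (B + 1%:M) = \rank (e (- 2)).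
Proof.
apply: (@kerdim_spectral1 _ (fun k => 2 + k)) => [k _|k _]; last first.
  by rewrite addrC addr_eq0.
have -> : (B + 1%:M)^T = B^T + 1%:M by rewrite linearD /= trmx1.
rewrite mulmxDl !mulmxDr mulmx1 !mul1mx orth_mx_tr//.
rewrite scalerDl -(sd_sym sd) -mul_scalar_mx -mulmxDl; congr (_ *m _).
apply/matrixP => i j; rewrite !mxE.
by case: (i == j); rewrite ?mulr1n ?mulr0n; ring.
Qed.

End Data.

(** Block elimination with pivot [b%:M] leaves the Schur complement X^2 + b^2 up to a scalar. For X
    = B - a this is the real product of B - lambda and B - conj lambda. *)
Lemma rank_realification n (X : 'M[R]_n) b : b != 0 ->
  (\rank (block_mx X b%:M (- b%:M) X) = n + \rank (X *m X + (b ^+ 2)%:M)%R)%N.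
Proof.
move=> b0.
pose L := block_mx 1%:M 0 (- b^-1 *: X) 1%:M.
pose L' := block_mx 1%:M 0 (b^-1 *: X) 1%:M.
pose C := block_mx 0 1%:M 1%:M (- b^-1 *: X).
pose C' := block_mx (b^-1 *: X) 1%:M 1%:M 0.
have LL : L *m L' = 1%:M.
  rewrite mulmx_block !(mulmx1, mul1mx, mulmx0, mul0mx, addr0, add0r).
  by rewrite scaleNr addNr -scalar_mx_block.
have CC : C *m C' = 1%:M.
  rewrite mulmx_block !(mulmx1, mul1mx, mulmx0, mul0mx, addr0, add0r).
  by rewrite scaleNr subrr -scalar_mx_block.
have [Lu _] := mulmx1_unit LL; have [Cu _] := mulmx1_unit CC.
set M := block_mx _ _ _ _.
have LM : L *m M = block_mx X b%:M (- b^-1 *: (X *m X + (b ^+ 2)%:M)) 0.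
  rewrite mulmx_block !(mul1mx, mul0mx, addr0); congr block_mx.
    rewrite -scalemxAl; apply/matrixP => i j; rewrite !mxE.
    by case: (i == j); rewrite ?mulr1n ?mulr0n; field.
  by rewrite mul_mx_scalar scalerA mulrN mulfV// scaleN1r addNr.
have LMC : L *m M *m C = block_mx b%:M 0 0 (- b^-1 *: (X *m X + (b ^+ 2)%:M)).
  rewrite LM mulmx_block !(mulmx1, mulmx0, mul0mx, addr0, add0r).
  by rewrite mul_scalar_mx scalerA mulrN mulfV// scaleN1r subrr.
transitivity (\rank (L *m M *m C)).
  rewrite mxrankMfree ?row_free_unit//.
  by rewrite eqmxMfull ?row_full_unit.
have rb : \rank (b%:M : 'M[R]_n) = n.
  by rewrite -scalemx1 mxrank_scale_nz// mxrank1.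
by rewrite LMC rank_diag_block_mx rb mxrank_scale_nz ?oppr_eq0 ?invr_eq0.
Qed.

Section Data2.
Variables (n : nat) (B : 'M[R]_n) (mu : seq R) (e J : R -> 'M[R]_n).
Hypothesis oB : orth_mx B.
Hypothesis sd : spectral_data B mu e J.

Lemma ckerdim_spectral (a b : R) : 0 < b ->
  ckerdim B a b =
  if a ^+ 2 + b ^+ 2 == 1 then (\rank (e (2 * a)) %/ 2)%N else 0%N.
Proof.
move=> b0; rewrite /ckerdim rank_realification ?lt0r_neq0// subnDl.
set M := (_ + _)%R; rewrite -/(kerdim M).
have [S SE] : exists S, S = B + B^T by eexists.
pose c := a ^+ 2 + b ^+ 2 - 1.
(* On the range of [e k], B^2 = k B - 1 turns [M] into (k - 2a) B + c; its Gram matrix is the scalar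
   [q k] because B + B^T acts there as k. *)
pose q k := (k - 2 * a) ^+ 2 + c ^+ 2 + c * (k - 2 * a) * k.
have ME : M = B *m S - (2 * a) *: B + c%:M.
  rewrite /M mulmxBl !mulmxBr mul_mx_scalar !mul_scalar_mx SE mulmxDr oB.
  rewrite scale_scalar_mx; move: (B *m B) => Y.
  apply/matrixP => i j; rewrite !mxE /c.
  by case: (i == j); rewrite ?mulr1n ?mulr0n; ring.
have MtE : M^T = B^T *m S - (2 * a) *: B^T + c%:M.
  have -> : B^T *m S = S *m B^T.
    by rewrite SE mulmxDr mulmxDl oB orth_mx_tr.
  have St : S^T = S by rewrite SE linearD /= trmxK addrC.
  by rewrite ME linearD linearB /= linearZ /= trmx_mul St tr_scalar_mx.
have Se k : S *m e k = k *: e k by rewrite SE; apply: (sd_sym sd).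
have Me k : M *m e k = (k - 2 * a) *: (B *m e k) + c *: e k.
  rewrite ME mulmxDl mulmxBl -mulmxA Se -scalemxAr -scalemxAl.
  by rewrite mul_scalar_mx (scalerBl k).
have Mte k : M^T *m e k = (k - 2 * a) *: (B^T *m e k) + c *: e k.
  rewrite MtE mulmxDl mulmxBl -mulmxA Se -scalemxAr -scalemxAl.
  by rewrite mul_scalar_mx (scalerBl k).
have MtBe k : M^T *m (B *m e k) = (k - 2 * a) *: e k + c *: (B *m e k).
  have -> : M^T *m (B *m e k) = (S - (2 * a)%:M) *m e k + c *: (B *m e k).
    have SB : S *m B = B *m S by rewrite SE mulmxDr mulmxDl oB orth_mx_tr.
    rewrite mulmxA scalemxAl -mulmxDl; congr (_ *m _).
    rewrite MtE 2!mulmxDl mulNmx -mulmxA SB mulmxA -scalemxAl orth_mx_tr// mul1mx.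
    by rewrite scalemx1 mul_scalar_mx.
  by rewrite mulmxBl Se mul_scalar_mx (scalerBl k).
have qE k : e k != 0 -> M^T *m M *m e k = q k *: e k.
  move=> _; rewrite -mulmxA Me mulmxDr -!scalemxAr MtBe Mte.
  have -> : B^T *m e k = k *: e k - B *m e k.
    by rewrite -Se SE mulmxDl [RHS]addrC addKr.
  move: (B *m e k) => Y; apply/matrixP => i j; rewrite !mxE /q.
  by ring.
have qpos k : e k != 0 -> q k = 0 -> k = 2 * a /\ c = 0.
  move=> /(sd_bound sd) k4 q0.
  have h : (k - 2 * a + c * k / 2) ^+ 2 + c ^+ 2 * (1 - k ^+ 2 / 4) = 0.
    by rewrite -[RHS]q0 /q; field.
  have h1 : 0 <= (k - 2 * a + c * k / 2) ^+ 2 by apply: sqr_ge0.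
  have h2 : 0 <= c ^+ 2 * (1 - k ^+ 2 / 4) by apply: mulr_ge0; [apply: sqr_ge0 | lra].
  have /eqP : c ^+ 2 * (1 - k ^+ 2 / 4) = 0 by lra.
  have /eqP : (k - 2 * a + c * k / 2) ^+ 2 = 0 by lra.
  rewrite sqrf_eq0 => /eqP uc; rewrite mulf_eq0 sqrf_eq0 => /orP[/eqP c0|k4'].
    by split=> //; move: uc; rewrite c0; lra.
  have bb : 0 < b ^+ 2 by rewrite exprn_gt0.
  (* At k = 2 or k = -2 the first square is that of (1 - a)^2 + b^2 or of (1 + a)^2 + b^2, which is
     positive since [b] is. *)
  have /eqP : k ^+ 2 = 2 ^+ 2 by move/eqP: k4'; lra.
  rewrite eqf_sqr => /orP[] /eqP kE; move: uc; rewrite kE /c.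
    by have := sqr_ge0 (1 - a); nra.
  by have := sqr_ge0 (1 + a); nra.
case: eqP => [ab|ab].
  congr (_ %/ 2)%N; apply: (kerdim_spectral1 sd qE) => k ek.
  apply/eqP/eqP => [/(qpos k ek)[]//|->].
  by rewrite /q subrr /c ab subrr; ring.
rewrite (kerdim_spectral sd qE) big_seq_cond big1 ?mxrank0// => k /andP[_ /eqP qk].
have [//|/qpos/(_ qk)[_ c0]] := eqVneq (e k) 0.
by case: ab; move: c0 => /eqP; rewrite subr_eq0 => /eqP.
Qed.
End Data2.

End Spec.

(** * Gluing isometries over families of orthogonal blocks *)

Section Match.
Variable R : rcfType.

(** Each step of [block_line] removes trace 2. Hence the halving in [ckerdim] loses nothing. *)
Lemma block_true_even n (E J : 'M[R]_n) : block true E J -> ~~ odd (\rank E).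
Proof.
have [N] := ubnP (\rank E); elim: N E J => // N IH E J rE bEJ.
have [->|E0] := eqVneq E 0; first by rewrite mxrank0.
have [x [y [_ _ _ trF bl]]] := block_line bEJ E0.
have [[_ EE] _ _] := bEJ; have [[_ FF] _ _] := bl.
have rk : \rank E = (\rank (E - (x^T *m x + y^T *m y))%R + 2)%N.
  apply/eqP; rewrite -(eqr_nat R) natrD -!mxtrace_idem// linearB /= trF.
  by apply/eqP => /=; ring.
rewrite rk oddD /= addbF; apply: IH bl.
by move: rE; rewrite rk; lia.
Qed.

(** A block is determined up to isometry by its kind and rank, so a permutation of these labels
    pairs the blocks; the isometries of the pairs have orthogonal ranges and add up. The matching is
    recorded from both sides because commutation will be carried in both directions. *)
Lemma family_intertwine (I I' : eqType) n m (K : seq I) (K' : seq I')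
    (b : I -> bool) (b' : I' -> bool)
    (e J : I -> 'M[R]_n) (e' J' : I' -> 'M[R]_m) :
  uniq K -> uniq K' ->
  (forall k, block (b k) (e k) (J k)) ->
  (forall k, block (b' k) (e' k) (J' k)) ->
  (forall k l, k != l -> e k *m e l = 0) ->
  (forall k l, k != l -> e' k *m e' l = 0) ->
  perm_eq [seq (b k, \rank (e k)) | k <- K] [seq (b' k, \rank (e' k)) | k <- K'] ->
  exists T : 'M[R]_(m, n),
    [/\ T *m T^T = \sum_(k <- K') e' k, T^T *m T = \sum_(k <- K) e k,
        forall k, k \in K -> exists2 l, l \in K' &
          T *m e k = e' l *m T /\ T *m J k = J' l *m T
      & forall l, l \in K' -> exists2 k, k \in K &
          T *m e k = e' l *m T /\ T *m J k = J' l *m T].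
Proof.
move=> + + bl bl' orth orth'; elim: K K' => [|k K IH] K' /=.
  move=> _ _ /perm_size/eqP; rewrite eq_sym size_map size_eq0 => /eqP->.
  by exists 0; rewrite !big_nil mul0mx mulmx0.
move=> /andP[kK Ku] K'u pK.
have : (b k, \rank (e k)) \in [seq (b' l, \rank (e' l)) | l <- K'].
  by rewrite -(perm_mem pK) mem_head.
case/mapP => l lK' [bkl rkl].
have pl := perm_to_rem lK'.
have lrem : l \notin rem l K' by rewrite mem_rem_uniqF.
have remu := rem_uniq l K'u.
have [|T1 [T1a T1b T1c T1d]] := IH (rem l K') Ku remu.
  have := perm_trans pK (perm_map (fun l => (b' l, \rank (e' l))) pl).
  by rewrite /= bkl rkl perm_cons.
have blk := bl k; rewrite bkl in blk.
have rkE : \tr (e k) = \tr (e' l).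
  have [[_ ee] _ _] := blk; have [[_ ee'] _ _] := bl' l.
  by rewrite !mxtrace_idem// rkl.
have [T0 [T0a T0b T0c]] := block_intertwine blk (bl' l) rkE.
have [[et ee] _ _] := bl k; have [[et' ee'] _ _] := bl' l.
have T0l := range_mulmxl T0a ee'.
have T0r := range_mulmxr T0b ee.
have sp i : sproj (e i) by case: (bl i).
have sp' i : sproj (e' i) by case: (bl' i).
have T1l := range_mulmxl T1a (proj2 (sproj_sum_orth sp' orth' remu)).
have T1r := range_mulmxr T1b (proj2 (sproj_sum_orth sp orth Ku)).
have ks : e k *m \sum_(i <- K) e i = 0.
  by apply: mulmx_sum_notin.
have ls : e' l *m \sum_(i <- rem l K') e' i = 0.
  by apply: mulmx_sum_notin.
have sk : (\sum_(i <- K) e i) *m e k = 0.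
  by apply: mulmx_0sym ks; [case: (sp k) | case: (sproj_sum_orth sp orth Ku)].
have sl : (\sum_(i <- rem l K') e' i) *m e' l = 0.
  by apply: mulmx_0sym ls; [case: (sp' l) | case: (sproj_sum_orth sp' orth' remu)].
have T1k : T1 *m e k = 0 by rewrite -T1r -mulmxA sk mulmx0.
have lT1 : e' l *m T1 = 0 by rewrite -T1l mulmxA ls mul0mx.
have eJ i : e i *m J i = J i by exact: block_mulEJ (bl i).
have Je i : J' i *m e' i = J' i by exact: block_mulJE (bl' i).
have T01 : T0 *m T1^T = 0.
  by rewrite -T0r -T1r trmx_mul (proj1 (sproj_sum_orth sp orth Ku)) mulmxA
             -[T0 *m e k *m _]mulmxA ks mulmx0 mul0mx.
have T01' : T0^T *m T1 = 0.
  by rewrite -T0l trmx_mul et' -mulmxA lT1 mulmx0.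
have T10 : T1 *m T0^T = 0 by rewrite -[LHS]trmxK trmx_mul trmxK T01 trmx0.
have T10' : T1^T *m T0 = 0 by rewrite -[LHS]trmxK trmx_mul trmxK T01' trmx0.
have TD : (T0 + T1)^T = T0^T + T1^T by rewrite linearD.
have split0 : (T0 + T1) *m e k = e' l *m (T0 + T1) /\
    (T0 + T1) *m J k = J' l *m (T0 + T1).
  split; first by rewrite mulmxDl mulmxDr T0r T1k T0l lT1.
  rewrite mulmxDl mulmxDr T0c; congr (_ + _).
  by rewrite -eJ mulmxA T1k mul0mx -Je -mulmxA lT1 mulmx0.
have split1 i j : i \in K -> j \in rem l K' ->
    T1 *m e i = e' j *m T1 -> T1 *m J i = J' j *m T1 ->
    (T0 + T1) *m e i = e' j *m (T0 + T1) /\ (T0 + T1) *m J i = J' j *m (T0 + T1).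
  move=> iK jK Te TJ.
  have T0i : T0 *m e i = 0.
    rewrite -T0r -mulmxA orth ?mulmx0//.
    by apply: contraNneq kK => ->.
  have jT0 : e' j *m T0 = 0.
    rewrite -T0l mulmxA orth' ?mul0mx//.
    by apply: contraNneq lrem => jl; rewrite -{1}jl.
  split; first by rewrite mulmxDl mulmxDr T0i jT0 Te.
  rewrite mulmxDl mulmxDr TJ; congr (_ + _).
  by rewrite -eJ mulmxA T0i mul0mx -Je -mulmxA jT0 mulmx0.
exists (T0 + T1); split.
- rewrite TD mulmxDl !mulmxDr T0a T01 T10 T1a addr0 add0r.
  by rewrite (perm_big _ pl) big_cons.
- by rewrite TD mulmxDl !mulmxDr T0b T01' T10' T1b addr0 add0r big_cons.
- move=> i; rewrite inE => /orP[/eqP->|iK]; first by exists l.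
  have [j jK [h1 h2]] := T1c i iK; exists j; first exact: mem_rem jK.
  exact: split1.
- move=> j jK'; have := perm_mem pl j; rewrite jK' inE => /esym/orP[/eqP->|jK].
    by exists k; rewrite ?mem_head.
  have [i iK [h1 h2]] := T1d j jK; exists i; first by rewrite inE iK orbT.
  exact: split1.
Qed.

End Match.

(** * Matching Segre symbols *)

Section Segre.
Variable R : rcfType.

(** One key for each conjugate pair of non-real eigenvalues, namely twice their real part; the
    condition on the square excludes the eigenvalues 1 and -1. *)
Definition rotation_keys n (mu : seq R) (e : R -> 'M[R]_n) : seq R :=
  [seq k <- mu | (k ^+ 2 != 4) && (e k != 0)].

Section OneMatrix.
Variables (n : nat) (B : 'M[R]_n) (mu : seq R) (e J : R -> 'M[R]_n).
Hypothesis oB : orth_mx B.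
Hypothesis sd : spectral_data B mu e J.
Let K := rotation_keys mu e.

Lemma rotation_keys_uniq : uniq [:: 2, -2 & K].
Proof.
have K4 k : k ^+ 2 = 4 -> k \notin K.
  by move=> k4; rewrite mem_filter k4 eqxx.
have two : (2 : R) != -2 by apply/eqP => h; lra.
rewrite /= inE negb_or two (filter_uniq _ (sd_uniq sd)) andbT /=.
by rewrite !K4//; ring.
Qed.

Lemma mem_rotation_keys k : e k != 0 -> k \in [:: 2, -2 & K].
Proof.
move=> ek; rewrite !inE mem_filter ek andbT.
have [//|k2] := eqVneq k 2; have [//|k2'] := eqVneq k (-2).
have -> : k ^+ 2 != 4.
  have -> : (4 : R) = 2 ^+ 2 by ring.
  by rewrite eqf_sqr negb_or k2.
by apply: contraNT ek => /(sd_out sd)/eqP.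
Qed.

Lemma sd_sum_keys : e 2 + (e (-2) + \sum_(k <- K) e k) = 1%:M.
Proof.
have -> : e 2 + (e (-2) + \sum_(k <- K) e k) = \sum_(k <- [:: 2, -2 & K]) e k.
  by rewrite !big_cons.
rewrite (sd_expand sd (\sum_(k <- _) _)) -(sd_sum sd); apply: eq_bigr => k _.
have [->|ek] := eqVneq (e k) 0; first by rewrite mulmx0.
have kK := mem_rotation_keys ek.
rewrite mulmx_suml (bigD1_seq k)//=; last exact: rotation_keys_uniq.
rewrite big1 ?addr0 => [|l lk]; last exact: (sd_orth sd).
by case: (sd_sproj sd k).
Qed.

Lemma mxrank_sum_sd (r : seq R) : uniq r ->
  \rank (\sum_(k <- r) e k)%R = (\sum_(k <- r) \rank (e k))%N.
Proof.
move=> ru; apply/eqP; rewrite -(eqr_nat R) natr_sum -mxtrace_idem; last first.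
  by case: (sproj_sum sd ru).
rewrite linear_sum /=; apply/eqP; apply: eq_bigr => k _.
by rewrite mxtrace_idem//; case: (sd_sproj sd k).
Qed.

Lemma sum_rank_keys :
  (\rank (e 2%R) + (\rank (e (-2)%R) + \sum_(k <- K) \rank (e k)))%N = n.
Proof.
have := mxrank_sum_sd rotation_keys_uniq; rewrite !big_cons sd_sum_keys mxrank1.
exact: esym.
Qed.

Lemma rotation_keys_even k : k \in K -> ~~ odd (\rank (e k)).
Proof.
rewrite mem_filter => /andP[/andP[k4 _] _].
by apply: (@block_true_even _ _ _ (J k)); have := sd_block sd k; rewrite k4.
Qed.

(** All eigenvalues lie on the unit circle, where a point with positive ordinate is determined by
    its abscissa: the pair (a, b) corresponds to the key 2a. *)
Lemma segre_rotation_keys s : segre_tilde B s ->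
  perm_eq s ([seq (\rank (e k) %/ 2)%N | k <- K] ++
    (if \rank (e (- 2)) != 0%N then [:: \rank (e (- 2))] else [::])).
Proof.
move=> [ls [lsu lsE]]; rewrite (kerdimD1 oB sd) => /perm_trans; apply.
rewrite perm_cat2r.
have lsP x : x \in ls ->
    [/\ 0 < x.2, x.1 ^+ 2 + x.2 ^+ 2 = 1, ckerdim B x.1 x.2 = (\rank (e (2 * x.1)%R) %/ 2)%N
      & e (2 * x.1) != 0].
  case: x => a b; rewrite lsE => /andP[b0] /=; rewrite (ckerdim_spectral oB sd)//.
  have [ab|//] := eqVneq (a ^+ 2 + b ^+ 2) 1 => h; split=> //.
  by apply: contraNneq h => ->; rewrite mxrank0.
have -> : [seq ckerdim B x.1 x.2 | x <- ls] =
    [seq (\rank (e k) %/ 2)%N | k <- [seq 2 * x.1 | x <- ls]].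
  by rewrite -map_comp; apply/eq_in_map => x /lsP[].
apply: perm_map; apply: uniq_perm.
- rewrite map_inj_in_uniq// => -[a b] [a' b'] /lsP[/= b0 ab _ _] /lsP[/= b0' ab' _ _] aa.
  have {aa}aa : a = a' by lra.
  rewrite -aa in ab' *; congr pair; apply/eqP.
  by rewrite -(eqrXn2 (n := 2))// ?ltW//; apply/eqP; lra.
- exact: filter_uniq (sd_uniq sd).
move=> k; apply/mapP/idP => [[x /lsP[b0 ab _ ek] ->]|kK].
  rewrite mem_filter ek andbT; apply/andP; split.
    apply/eqP => h; have : 0 < x.2 ^+ 2 by rewrite exprn_gt0.
    by move: h; rewrite exprMn; lra.
  by apply: contraNT ek => /(sd_out sd)/eqP.
have := kK; rewrite mem_filter => /andP[/andP[k4 ek] _].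
have k4' : k ^+ 2 < 4 by rewrite lt_neqAle k4 (sd_bound sd).
have b0 : 0 < Num.sqrt (1 - k ^+ 2 / 4) by rewrite sqrtr_gt0; lra.
exists (k / 2, Num.sqrt (1 - k ^+ 2 / 4)) => /=; last by field.
rewrite lsE b0 (ckerdim_spectral oB sd)//.
have -> : (k / 2) ^+ 2 + Num.sqrt (1 - k ^+ 2 / 4) ^+ 2 == 1.
  by rewrite sqr_sqrtr; [apply/eqP; field | lra].
have -> : 2 * (k / 2) = k by field.
(* Evenness matters: a rank of 1 would be halved to 0 and the pair would be absent from [ls]. *)
have := rotation_keys_even kK; have : \rank (e k) != 0%N by rewrite mxrank_eq0.
by move: (\rank _); lia.
Qed.

(** Counterpart of [sd_comm]: by [sd_act], [B] is a combination of the [e k] and [J k], and the keys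
    carry all the nonzero eigenprojections. *)
Lemma comm_from_keys (Q : 'M[R]_n) :
  (forall k, k \in [:: 2, -2 & K] -> Q *m e k = e k *m Q /\ Q *m J k = J k *m Q) ->
  Q *m B = B *m Q.
Proof.
move=> h.
have Be : B = \sum_(k <- [:: 2, -2 & K]) B *m e k.
  by rewrite -mulmx_sumr !big_cons sd_sum_keys mulmx1.
rewrite Be mulmx_sumr mulmx_suml; apply: eq_big_seq => k /h[h1 h2].
by rewrite (sd_act sd) mulmxDr mulmxDl -!scalemxAl -!scalemxAr h1 h2.
Qed.

End OneMatrix.

Section TwoMatrices.
Variables (n m : nat) (A : 'M[R]_n) (B : 'M[R]_m) (s : seq nat).
Variables (mu mu' : seq R) (e J : R -> 'M[R]_n) (e' J' : R -> 'M[R]_m).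
Hypotheses (oA : orth_mx A) (oB : orth_mx B).
Hypotheses (sd : spectral_data A mu e J) (sd' : spectral_data B mu' e' J').
Hypotheses (sA : segre_tilde A s) (sB : segre_tilde B s).
Hypotheses (B1 : kerdim (B - 1%:M) = 0%N) (mE : (m = n - kerdim (A - 1%:M))%N).
Let K := rotation_keys mu e.
Let K' := rotation_keys mu' e'.

(* The Segre symbol does not say which entry belongs to the eigenvalue -1; the
   dimension does, since [m] is twice the sum of the entries minus that one. *)
Lemma segre_perm_eq :
  perm_eq [seq (k ^+ 2 != 4, \rank (e k)) | k <- -2 :: K]
          [seq (k ^+ 2 != 4, \rank (e' k)) | k <- -2 :: K'].
Proof.
have half p (f : R -> 'M[R]_p) (L : seq R) : (forall k, k \in L -> ~~ odd (\rank (f k))) ->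
  (\sum_(k <- L) \rank (f k) = 2 * sumn [seq \rank (f k) %/ 2 | k <- L])%N.
  elim: L => [|k L IH] h; first by rewrite big_nil.
  rewrite big_cons IH /= => [|i iL]; last by apply: h; rewrite inE iL orbT.
  by have := h k (mem_head _ _); move: (\rank _) (sumn _); lia.
have tail x : sumn (if x != 0%N then [:: x] else [::]) = x by case: x => //= x; rewrite addn0.
have p := segre_rotation_keys oA sd sA.
have p' := segre_rotation_keys oB sd' sB.
have := perm_sumn p; have := perm_sumn p'; rewrite !sumn_cat !tail => s1 s2.
have rA := sum_rank_keys sd; have rB := sum_rank_keys sd'.
rewrite -(kerdimB1 oA sd) (half _ _ _ (@rotation_keys_even _ _ _ _ _ sd)) in rA.
rewrite -(kerdimB1 oB sd') (half _ _ _ (@rotation_keys_even _ _ _ _ _ sd')) B1 in rB.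
have r2 : \rank (e (-2)) = \rank (e' (-2)) by lia.
rewrite perm_sym in p; have := perm_trans p p'; rewrite r2 perm_cat2r => pp.
rewrite /= r2 perm_cons.
have double q (f : R -> 'M[R]_q) nu :
    (forall k, k \in rotation_keys nu f -> ~~ odd (\rank (f k))) ->
    [seq (k ^+ 2 != 4, \rank (f k)) | k <- rotation_keys nu f] =
    [seq (true, 2 * h)%N | h <- [seq (\rank (f k) %/ 2)%N | k <- rotation_keys nu f]].
  move=> ev; rewrite -map_comp; apply/eq_in_map => k kK /=.
  have := ev k kK; have := kK; rewrite mem_filter => /andP[/andP[-> _] _].
  by move: (\rank _) => r hr; congr pair; lia.
rewrite (double _ _ _ (@rotation_keys_even _ _ _ _ _ sd)).
rewrite (double _ _ _ (@rotation_keys_even _ _ _ _ _ sd')).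
exact: perm_map pp.
Qed.

Lemma comm_transfer (U : 'M[R]_(m, n)) (X : 'M[R]_n) (Y Q : 'M[R]_m) :
  U *m X = Y *m U -> U^T *m Y = X *m U^T -> Q *m Y = Y *m Q ->
  (U^T *m Q *m U) *m X = X *m (U^T *m Q *m U).
Proof.
by move=> UX UY QY; rewrite -mulmxA UX !mulmxA -[_ *m Q *m Y]mulmxA QY mulmxA UY.
Qed.

(* [U] is an isometry of ker(A - I)^perp onto R^m. It need not conjugate [A] to
   [B], whose eigenvalues may differ, but it matches the eigenspaces and
   complex structures that determine the invariant subspaces. *)
Lemma exists_matching_isometry : exists U : 'M[R]_(m, n),
  [/\ U *m U^T = 1%:M, U^T *m U = 1%:M - e 2
    & forall Q : 'M[R]_m, Q^T = Q ->
        (Q *m B = B *m Q <-> (U^T *m Q *m U) *m A = A *m (U^T *m Q *m U))].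
Proof.
have Ku : uniq (-2 :: K) by have /andP[_] := rotation_keys_uniq sd.
have K'u : uniq (-2 :: K') by have /andP[_] := rotation_keys_uniq sd'.
have [U [UUt UtU UK UK']] := family_intertwine Ku K'u (sd_block sd) (sd_block sd')
  (sd_orth sd) (sd_orth sd') segre_perm_eq.
have e'2 : e' 2 = 0.
  by apply/eqP; rewrite -mxrank_eq0 -(kerdimB1 oB sd') B1.
have {}UUt : U *m U^T = 1%:M.
  by rewrite UUt -(sd_sum_keys sd') big_cons e'2 add0r.
have {}UtU : U^T *m U = 1%:M - e 2.
  by rewrite UtU -(sd_sum_keys sd) big_cons addrAC subrr add0r.
exists U; split=> // Q Qt.
have sq4 (k : R) : k ^+ 2 = 4 -> (k ^+ 2 != 4) = false by move=> ->; rewrite eqxx.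
have J0 : J 2 = 0.
  by apply: (@block_false_eq0 _ _ (e 2)); have := sd_block sd 2; rewrite sq4//; ring.
have J0' : J' 2 = 0.
  by apply: (@block_false_eq0 _ _ (e' 2)); have := sd_block sd' 2; rewrite sq4//; ring.
have Ue2 : U *m e 2 = 0.
  have : U *m (U^T *m U) = U by rewrite mulmxA UUt mul1mx.
  by rewrite UtU mulmxBr mulmx1 => /eqP; rewrite -subr_eq0 addrAC subrr add0r oppr_eq0 => /eqP.
have e2U : e 2 *m U^T = 0.
  by rewrite -[e 2](proj1 (sd_sproj sd 2)) -trmx_mul Ue2 trmx0.
have trE k l : U *m e k = e' l *m U -> U^T *m e' l = e k *m U^T.
  move=> /(congr1 trmx); rewrite !trmx_mul.
  by rewrite (proj1 (sd_sproj sd k)) (proj1 (sd_sproj sd' l)).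
have trJ k l : U *m J k = J' l *m U -> U^T *m J' l = J k *m U^T.
  move=> /(congr1 trmx); rewrite !trmx_mul.
  have [_ -> _] := sd_block sd k; have [_ -> _] := sd_block sd' l.
  by rewrite mulmxN mulNmx => /oppr_inj.
split=> comm.
(* At the key 2 every product vanishes, since [U] kills the range of [e 2] and [J 2] is zero. *)
- apply: (comm_from_keys sd) => k; rewrite inE => /orP[/eqP->|/UK[l _ [Ue UJ]]].
    rewrite J0 mulmx0 mul0mx -!mulmxA Ue2 !mulmx0; split=> //.
    by rewrite mulmxA e2U mul0mx.
  have [Qe QJ] := sd_comm sd' Qt comm l.
  by split; apply: comm_transfer; eauto.
- have [P PE] : exists P, P = U^T *m Q *m U by eexists.
  rewrite -PE in comm.
  have Pt : P^T = P by rewrite PE !trmx_mul trmxK Qt mulmxA.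
  have QP : Q = U *m P *m U^T.
    by rewrite PE !mulmxA UUt mul1mx -mulmxA UUt mulmx1.
  apply: (comm_from_keys sd') => l; rewrite inE => /orP[/eqP->|/UK'[k _ [Ue UJ]]].
    by rewrite J0' e'2 !mulmx0 !mul0mx.
  have [Pe PJ] := sd_comm sd Pt comm k.
  have transfer X Y : U *m X = Y *m U -> U^T *m Y = X *m U^T -> P *m X = X *m P ->
      Q *m Y = Y *m Q.
    move=> UX UY PX; rewrite QP -mulmxA UY !mulmxA -[U *m P *m X]mulmxA PX.
    by rewrite !mulmxA UX.
  by split; apply: transfer; eauto.
Qed.

End TwoMatrices.
End Segre.

(** * Invariant flats *)

Section Invariant.
Variable R : rcfType.

(** [A *m P *m A^T] projects onto the image of the subspace under [A]. Invariance puts this image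
    inside the subspace, so the difference of the projections is a projection; its trace is 0. *)
Lemma invariant_comm n (A P : 'M[R]_n) : orth_mx A -> sproj P ->
  P *m A^T *m P = P *m A^T -> P *m A = A *m P.
Proof.
move=> oA spP inv; have [Pt PP] := spP.
have AtA := orth_mx_tr oA.
have inv' : P *m A *m P = A *m P.
  by have := congr1 trmx inv; rewrite !trmx_mul trmxK Pt mulmxA.
have spY : sproj (A *m P *m A^T).
  split; first by rewrite !trmx_mul trmxK Pt mulmxA.
  by rewrite !mulmxA -[A *m P *m A^T *m A]mulmxA AtA mulmx1 -[A *m P *m P]mulmxA PP.
have spD : sproj (P - A *m P *m A^T) by apply: sprojB => //; rewrite !mulmxA inv'.
have PY : P = A *m P *m A^T.
  apply/eqP; rewrite -subr_eq0; apply/eqP/(sproj_tr_eq0 spD).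
  by rewrite linearB /= mxtrace_mulC mulmxA AtA mul1mx subrr.
by rewrite [in LHS]PY -mulmxA AtA mulmx1.
Qed.

Lemma rows_fixed n (P X : 'M[R]_n) : P *m P = P ->
  (forall x : 'rV[R]_n, x *m P = x -> (x *m X) *m P = x *m X) ->
  P *m X *m P = P *m X.
Proof.
move=> PP h; apply/row_matrixP => i.
by rewrite !row_mul h// -row_mul PP.
Qed.

Lemma comm_tr n (B P : 'M[R]_n) : P^T = P -> P *m B = B *m P -> P *m B^T = B^T *m P.
Proof. by move=> Pt h; have := congr1 trmx h; rewrite !trmx_mul Pt. Qed.

Lemma Sinv_comm n (B P : 'M[R]_n) k : orth_mx B ->
  Sinv B k P <-> is_proj k P /\ P *m B = B *m P.
Proof.
move=> oB; split=> -[prP h]; split=> //; have [Pt PP _] := prP.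
  exact/invariant_comm/rows_fixed.
by move=> x xP; rewrite -mulmxA -comm_tr// mulmxA xP.
Qed.

(** A flat is carried to itself when its direction is invariant and the displacement of its foot
    point lies in that direction. Commutation holds for [A] and [A^T] alike, which gives both
    inclusions. *)
Lemma Gamma_comm n (A : 'M[R]_n) a k c : orth_mx A ->
  Gamma A a k c <-> [/\ aff_code k c, c.1 *m A = A *m c.1 &
    (aff_apply A a c.2 - c.2) *m c.1 = aff_apply A a c.2 - c.2].
Proof.
case: c => P q oA; rewrite /Gamma /aff_points /aff_apply /=.
have AtA := orth_mx_tr oA.
split=> [[ac h]|[ac PA g]].
  have [[Pt PP _] _] := ac.
  have gP : (q *m A^T + a - q) *m P = q *m A^T + a - q.
    by apply/h; exists q => //; rewrite subrr mul0mx.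
  split=> //=; apply: invariant_comm => //; apply: rows_fixed => // w wP.
  have : ((q + w) *m A^T + a - q) *m P = (q + w) *m A^T + a - q.
    by apply/h; exists (q + w) => //; rewrite addrAC subrr add0r.
  have -> : (q + w) *m A^T + a - q = w *m A^T + (q *m A^T + a - q).
    by rewrite mulmxDl [q *m _ + _]addrC -!addrA.
  by rewrite mulmxDl gP => /addIr.
split=> // y; have [[Pt PP _] _] := ac.
have PAt := comm_tr Pt PA.
split=> [yP|[x xP <-]].
  exists ((y - a) *m A); last by rewrite -mulmxA oA mulmx1 subrK.
  have -> : (y - a) *m A - q = ((y - q) - (q *m A^T + a - q)) *m A.
    rewrite opprB addrA subrK opprD addrA -!addrA [- _ - a]addrC !addrA.
    by rewrite [in RHS]mulmxBl -[q *m A^T *m A]mulmxA AtA mulmx1.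
  by rewrite -mulmxA -PA mulmxA mulmxBl yP g.
have -> : x *m A^T + a - q = (x - q) *m A^T + (q *m A^T + a - q).
  by rewrite mulmxBl !addrA subrK.
by rewrite mulmxDl g -mulmxA -PAt mulmxA xP.
Qed.

(** * The fixed space of the linear part and the normal form of the motion *)

Section Frame.
Variables (n : nat) (A : 'M[R]_n) (a : 'rV[R]_n).
Variables (mu : seq R) (e J : R -> 'M[R]_n).
Hypothesis (oA : orth_mx A) (sd : spectral_data A mu e J).

Lemma mulmx_A_e2 : A *m e 2 = e 2.
Proof.
have J0 : J 2 = 0.
  apply: (@block_false_eq0 _ _ (e 2)); have := sd_block sd 2.
  by have -> : (2 : R) ^+ 2 = 4 by [ring]; rewrite eqxx.
by rewrite (sd_act sd) J0 scaler0 addr0 divff ?scale1r// pnatr_eq0.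
Qed.

Lemma mulmx_At_e2 : A^T *m e 2 = e 2.
Proof. by rewrite -{1}mulmx_A_e2 mulmxA orth_mx_tr// mul1mx. Qed.

Lemma mulmx_e2_At : e 2 *m A^T = e 2.
Proof.
by have := congr1 trmx mulmx_A_e2; rewrite trmx_mul (proj1 (sd_sproj sd 2)).
Qed.

Lemma mulmx_e2_A : e 2 *m A = e 2.
Proof.
by have := congr1 trmx mulmx_At_e2; rewrite trmx_mul trmxK (proj1 (sd_sproj sd 2)).
Qed.

(** The opposite inclusion is immediate from [mulmx_At_e2], and the ranks agree by [kerdimB1]. This
    lets the equation for [v] in the normal form be solved. *)
Lemma submx_e2_compl : (1%:M - e 2 <= A^T - 1%:M)%MS.
Proof.
have [E1 E2] := sd_sproj sd 2.
have le : (A^T - 1%:M <= 1%:M - e 2)%MS.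
  apply/submxP; exists (A^T - 1%:M).
  by rewrite mulmxBr mulmx1 mulmxBl mul1mx mulmx_At_e2 subrr subr0.
have rk : \rank (1%:M - e 2) = \rank (A^T - 1%:M).
  have -> : A^T - 1%:M = (A - 1%:M)^T by rewrite linearB /= trmx1.
  rewrite mxrank_tr -sproj_rank_compl; last exact: sd_sproj sd 2.
  by rewrite /kerdim -(kerdimB1 oA sd) /kerdim subKn// rank_leq_row.
by have := mxrank_leqif_sup le => /leqifP; rewrite rk; case: ifP => //; rewrite ltnn.
Qed.

Lemma fixed_e2 p (X : 'M[R]_(p, n)) : X *m A^T = X -> X *m e 2 = X.
Proof.
move=> XAt; have /submxP[Y YE] := submx_e2_compl.
have XA : X *m A = X by rewrite -[in LHS]XAt -mulmxA orth_mx_tr// mulmx1.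
apply/eqP; rewrite eq_sym -subr_eq0 -[X in X - _]mulmx1 -mulmxBr.
have -> : 1%:M - e 2 = (A - 1%:M) *m Y^T.
  have := congr1 trmx YE; rewrite trmx_mul !linearB /= trmx1 trmxK.
  by rewrite (proj1 (sd_sproj sd 2)).
by rewrite mulmxA mulmxBr XA mulmx1 subrr mul0mx.
Qed.

(** The equation says f(v) = v + a0, where [a0] is the component of [a] in ker(A - I). If [a0] is
    zero then [v] is fixed; a fixed point p gives a = p - p A^T, whose component there is zero. *)
Lemma affine_normal_form : exists v a0 : 'rV[R]_n,
  [/\ a = a0 - v *m (A^T - 1%:M), a0 *m e 2 = a0 & (a0 == 0) <-> elliptic A a].
Proof.
have /submxP[Y YE] := submx_e2_compl.
have [E1 E2] := sd_sproj sd 2.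
pose v := - (a *m Y); pose a0 := a *m e 2.
have aE : a = a0 - v *m (A^T - 1%:M).
  by rewrite /v mulNmx opprK -mulmxA -YE mulmxBr mulmx1 addrC subrK.
exists v, a0; split=> //; first by rewrite /a0 -mulmxA E2.
split=> [/eqP a00|[p pE]].
  exists v; rewrite /aff_apply aE a00 add0r mulmxBr mulmx1 opprB.
  by rewrite addrC subrK.
rewrite /aff_apply in pE; rewrite /a0.
have -> : a = p - p *m A^T by rewrite -[X in X - _]pE addrC addKr.
by rewrite mulmxBl -mulmxA mulmx_At_e2 subrr.
Qed.

(* [D] projects onto the line of the translation part (onto 0 if [f] is
   elliptic) and [Z] identifies the rest of ker(A - I) with E^(r - d). *)
Lemma translation_frame (a0 : 'rV[R]_n) d : a0 *m e 2 = a0 ->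
    (d = 0%N /\ a0 = 0) \/ (d = 1%N /\ a0 != 0) ->
  exists (D : 'M[R]_n) (Z : 'M[R]_(kerdim (A - 1%:M) - d, n)),
    [/\ sproj D, \tr D = d%:R, a0 *m D = a0 &
     [/\ e 2 *m D = D, forall P : 'M[R]_n, a0 *m P = a0 -> D *m P = D,
         Z *m Z^T = 1%:M & Z^T *m Z = e 2 - D]].
Proof.
move=> a0e hd; have [E1 E2] := sd_sproj sd 2.
have [D [spD trD a0D eD DP]] : exists D : 'M[R]_n, [/\ sproj D, \tr D = d%:R,
    a0 *m D = a0, e 2 *m D = D & forall P : 'M[R]_n, a0 *m P = a0 -> D *m P = D].
  case: hd => -[-> a00].
    exists 0; split; rewrite ?a00 ?mulmx0 ?mxtrace0//; first exact: sproj0.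
    by move=> P _; rewrite mul0mx.
  pose c := (a0 *m a0^T) 0 0.
  have c0 : c != 0 by rewrite mul_trmx_eq0.
  have cE : a0 *m a0^T = c%:M by apply: mx11_scalar.
  exists (c^-1 *: (a0^T *m a0)); split.
  - split; first by rewrite linearZ /= trmx_mul trmxK.
    rewrite -scalemxAl -scalemxAr -mulmxA [a0 *m (_ *m _)]mulmxA cE mul_scalar_mx.
    by rewrite -scalemxAr [_ *: (c *: _)]scalerA mulVf// scale1r.
  - by rewrite linearZ /= mxtrace_mulC cE mxtrace_scalar mulr1n mulVf.
  - by rewrite -scalemxAr mulmxA cE mul_scalar_mx scalerA mulVf// scale1r.
  - rewrite -scalemxAr mulmxA -{1}E1 -trmx_mul a0e //.
  - by move=> P aP; rewrite -scalemxAl -mulmxA aP.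
exists D.
have sp : sproj (e 2 - D) by apply: sprojB.
have tr : \tr (e 2 - D) = \tr (1%:M : 'M[R]_(kerdim (A - 1%:M) - d)).
  have dr : (d <= kerdim (A - 1%:M))%N.
    case: hd => -[-> a00] //; rewrite lt0n (kerdimB1 oA sd) mxrank_eq0.
    by apply: contraNneq a00 => e20; rewrite -a0e e20 mulmx0.
  by rewrite linearB /= trD mxtrace1 mxtrace_idem// -(kerdimB1 oA sd) (natrB _ dr).
(* With zero complex structures, [block_intertwine] is plain isometry of spaces of equal
   dimension. *)
have [Z [ZZ ZtZ _]] := block_intertwine (block_false sp) (block_false (sproj1 R _)) tr.
by exists Z.
Qed.

End Frame.
End Invariant.

(** * Lipschitz bounds and continuity for the code metrics *)

Section Lipschitz.
Variable R : rcfType.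

Lemma le_mdist p q (M N : 'M[R]_(p, q)) i j : `|M i j - N i j| <= mdist M N.
Proof.
apply: le_trans (le_bigmax _ _ i).
exact: (le_bigmax _ (fun j => `|M i j - N i j|) j).
Qed.

Lemma mdist_le p q (M N : 'M[R]_(p, q)) c : 0 <= c ->
  (forall i j, `|M i j - N i j| <= c) -> mdist M N <= c.
Proof. by move=> c0 h; apply: bigmax_le => // i _; apply: bigmax_le. Qed.

Lemma mdist_ge0 p q (M N : 'M[R]_(p, q)) : 0 <= mdist M N.
Proof. exact: bigmax_ge_id. Qed.

Definition lipschitz (X Y : Type) (dX : X -> X -> R) (dY : Y -> Y -> R) (f : X -> Y) :=
  exists2 C, 0 <= C & forall x y, dY (f x) (f y) <= C * dX x y.

Section Lip.
Variables (X : Type) (dX : X -> X -> R).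
Hypothesis dX0 : forall x y, 0 <= dX x y.

Lemma lipschitz_mulmxl p q q' (L : 'M[R]_(p, q)) (f : X -> 'M[R]_(q, q')) :
  lipschitz dX (@mdist R _ _) f -> lipschitz dX (@mdist R _ _) (fun x => L *m f x).
Proof.
move=> [C C0 fC]; pose s := \sum_i \sum_k `|L i k|.
have s0 : 0 <= s by rewrite sumr_ge0// => i _; rewrite sumr_ge0.
exists (s * C) => [|x y]; first exact: mulr_ge0.
apply: mdist_le => [|i j]; first by rewrite !mulr_ge0.
rewrite !mxE -sumrB; apply: le_trans (ler_norm_sum _ _ _) _.
apply: (@le_trans _ _ ((\sum_k `|L i k|) * (C * dX x y))).
  rewrite mulr_suml ler_sum// => k _; rewrite -mulrBr normrM ler_wpM2l//.
  exact: le_trans (le_mdist _ _ _ _) (fC x y).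
rewrite -mulrA ler_wpM2r ?mulr_ge0//.
rewrite /s (bigD1 i)//= lerDl sumr_ge0// => ? _; exact: sumr_ge0.
Qed.

Lemma lipschitz_trmx p q (f : X -> 'M[R]_(p, q)) :
  lipschitz dX (@mdist R _ _) f -> lipschitz dX (@mdist R _ _) (fun x => (f x)^T).
Proof.
move=> [C C0 fC]; exists C => // x y; apply: mdist_le => [|i j]; first exact: mulr_ge0.
by rewrite !mxE; apply: le_trans (le_mdist _ _ _ _) (fC x y).
Qed.

Lemma lipschitz_mulmxr p q q' (L : 'M[R]_(q, q')) (f : X -> 'M[R]_(p, q)) :
  lipschitz dX (@mdist R _ _) f -> lipschitz dX (@mdist R _ _) (fun x => f x *m L).
Proof.
move=> /lipschitz_trmx/(lipschitz_mulmxl L^T)/lipschitz_trmx [C C0 fC].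
by exists C => // x y; have := fC x y; rewrite !trmx_mul !trmxK.
Qed.

Lemma lipschitzD p q (f g : X -> 'M[R]_(p, q)) :
  lipschitz dX (@mdist R _ _) f -> lipschitz dX (@mdist R _ _) g ->
  lipschitz dX (@mdist R _ _) (fun x => f x + g x).
Proof.
move=> [C C0 fC] [D D0 gD]; exists (C + D) => [|x y]; first exact: addr_ge0.
apply: mdist_le => [|i j]; first by rewrite mulr_ge0// addr_ge0.
rewrite !mxE opprD addrACA mulrDl; apply: le_trans (ler_normD _ _) _.
apply: lerD; first exact: le_trans (le_mdist _ _ _ _) (fC x y).
exact: le_trans (le_mdist _ _ _ _) (gD x y).
Qed.

Lemma lipschitzN p q (f : X -> 'M[R]_(p, q)) :
  lipschitz dX (@mdist R _ _) f -> lipschitz dX (@mdist R _ _) (fun x => - f x).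
Proof.
move=> [C C0 fC]; exists C => // x y; apply: mdist_le => [|i j]; first exact: mulr_ge0.
rewrite !mxE -opprD normrN.
exact: le_trans (le_mdist _ _ _ _) (fC x y).
Qed.

Lemma lipschitz_cst p q (M : 'M[R]_(p, q)) : lipschitz dX (@mdist R _ _) (fun=> M).
Proof.
exists 0 => // x y; rewrite mul0r; apply: mdist_le => // i j.
by rewrite subrr normr0.
Qed.

Lemma lipschitz_pair (Y Z : Type) dY dZ (f : X -> Y) (g : X -> Z) :
  lipschitz dX dY f -> lipschitz dX dZ g ->
  lipschitz dX (@pdist R Y Z dY dZ) (fun x => (f x, g x)).
Proof.
move=> [C C0 fC] [D D0 gD]; exists (C + D) => [|x y]; first exact: addr_ge0.
rewrite /pdist ge_max mulrDl /=; apply/andP; split.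
  by apply: le_trans (fC x y) _; rewrite lerDl mulr_ge0.
by apply: le_trans (gD x y) _; rewrite lerDr mulr_ge0.
Qed.

Lemma lipschitz_fst (Y Z : Type) dY dZ (f : X -> Y * Z) :
  lipschitz dX (@pdist R Y Z dY dZ) f -> lipschitz dX dY (fun x => (f x).1).
Proof.
move=> [C C0 fC]; exists C => // x y.
by have := fC x y; rewrite /pdist ge_max => /andP[].
Qed.

Lemma lipschitz_snd (Y Z : Type) dY dZ (f : X -> Y * Z) :
  lipschitz dX (@pdist R Y Z dY dZ) f -> lipschitz dX dZ (fun x => (f x).2).
Proof.
move=> [C C0 fC]; exists C => // x y.
by have := fC x y; rewrite /pdist ge_max => /andP[].
Qed.

Lemma lipschitz_id : lipschitz dX dX id.
Proof. by exists 1 => // x y; rewrite mul1r. Qed.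

Lemma lipschitz_trace p (f : X -> 'M[R]_p) : lipschitz dX (@mdist R _ _) f ->
  lipschitz dX (fun u v : R => `|u - v|) (fun x => \tr (f x)).
Proof.
move=> [C C0 fC]; exists (p%:R * C) => [|x y]; first by rewrite mulr_ge0.
rewrite /mxtrace -sumrB; apply: le_trans (ler_norm_sum _ _ _) _.
rewrite -mulrA mulr_natl -[p in X in _ <= X]card_ord -sumr_const.
by apply: ler_sum => i _; exact: le_trans (le_mdist _ _ _ _) (fC x y).
Qed.

End Lip.

(** The bound is asked only at small distances, because [tdist] jumps to 1 between summands. *)
Lemma cont_on_local_lipschitz (X Y : Type) (dX : X -> X -> R) (dY : Y -> Y -> R)
    (D : X -> Prop) (F : X -> Y) C : 0 <= C ->
  (forall x y, D x -> D y -> C * dX x y < 1 -> dX x y < 1 -> dY (F x) (F y) <= C * dX x y) ->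
  cont_on dX dY D F.
Proof.
move=> C0 h x Dx eps eps0.
have C1 : 0 < C + 1 by rewrite ltr_wpDl.
(* The three terms give distance below 1, C times the distance below 1, and the final bound; C + 1
   is invertible even when C is 0. *)
exists (Num.min 1 (Num.min (C + 1)^-1 (eps / (C + 1)))) => [|y Dy].
  by rewrite !lt_min ltr01 invr_gt0 C1 divr_gt0.
rewrite !lt_min => /and3P[d1 d2 d3].
have [dneg|dpos] := ltrP (dX x y) 0.
  have Cd : C * dX x y <= 0 by rewrite mulr_ge0_le0// ltW.
  by apply: le_lt_trans (h _ _ Dx Dy _ d1) _; apply: le_lt_trans Cd _.
have Cd : C * dX x y <= (C + 1) * dX x y by rewrite ler_wpM2r// lerDl.
rewrite -div1r ltr_pdivlMr// mulrC in d2; rewrite ltr_pdivlMr// mulrC in d3.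
apply: le_lt_trans (h _ _ Dx Dy _ d1) _; exact: le_lt_trans Cd _.
Qed.

Lemma pdist_ge0 (X Y : Type) (dX : X -> X -> R) (dY : Y -> Y -> R) :
  (forall x y, 0 <= dX x y) -> forall x y, 0 <= pdist dX dY x y.
Proof. by move=> h x y; rewrite /pdist le_max h. Qed.

End Lipschitz.

Lemma natr_dist_lt1 (R : realDomainType) (i j : nat) : `|i%:R - j%:R : R| < 1 -> i = j.
Proof.
have h (x y : nat) : (x < y)%N -> 1 <= `|x%:R - y%:R : R|.
  move=> xy; rewrite distrC ger0_norm ?subr_ge0 ?ler_nat 1?ltnW//.
  by rewrite lerBrDr -[1]/1%:R -natrD ler_nat add1n.
by case: (ltngtP i j) => // /h; [|rewrite distrC] => /le_lt_trans h' /h'; rewrite ltxx.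
Qed.

(** * The two mutually inverse maps and their continuity *)

Section Homeomorphism.
Variables (R : rcfType) (n m l d : nat) (A : 'M[R]_n) (a v a0 : 'rV[R]_n) (phi : 'M[R]_m).
Variables (mu : seq R) (e J : R -> 'M[R]_n).
Variables (U : 'M[R]_(m, n)) (D : 'M[R]_n) (Z : 'M[R]_(l, n)).
Hypotheses (oA : orth_mx A) (ophi : orth_mx phi) (sd : spectral_data A mu e J).
Hypotheses (aE : a = a0 - v *m (A^T - 1%:M)) (a0e : a0 *m e 2 = a0).
Hypotheses (UUt : U *m U^T = 1%:M) (UtU : U^T *m U = 1%:M - e 2).
Hypothesis Ucomm : forall Q : 'M[R]_m, Q^T = Q ->
  (Q *m phi = phi *m Q <-> (U^T *m Q *m U) *m A = A *m (U^T *m Q *m U)).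
Hypotheses (spD : sproj D) (trD : \tr D = d%:R) (a0D : a0 *m D = a0).
Hypotheses (eD : e 2 *m D = D)
  (DP : forall P : 'M[R]_n, a0 *m P = a0 -> D *m P = D).
Hypotheses (ZZt : Z *m Z^T = 1%:M) (ZtZ : Z^T *m Z = e 2 - D).

Local Notation K := (e 2).

(** The last component is the foot point (q - v)(1 - P) of the flat translated by -v, read in the
    coordinates [Z]; as q P = 0 on codes, it can be written affinely in (P, q). *)
Definition flat_split (c : 'M[R]_n * 'rV[R]_n) :
    nat * ('M[R]_m * ('M[R]_l * 'rV[R]_l)) :=
  (\rank (U *m c.1 *m U^T),
   (U *m c.1 *m U^T, (Z *m c.1 *m Z^T, (c.2 - v + v *m c.1) *m Z^T))).

(* The foot point is (q2 Z + v) (1 - P); as q2 Z P = 0 on [union_set], it is written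
   as an affine function of the code, so that continuity is a Lipschitz bound. *)
Definition flat_join (z : nat * ('M[R]_m * ('M[R]_l * 'rV[R]_l))) :
    'M[R]_n * 'rV[R]_n :=
  let P := U^T *m z.2.1 *m U + D + Z^T *m z.2.2.1 *m Z in
  (P, z.2.2.2 *m Z + v - v *m P).

Let Kt : K^T = K. Proof. by case: (sd_sproj sd 2). Qed.
Let KK : K *m K = K. Proof. by case: (sd_sproj sd 2). Qed.
Let UK : U *m K = 0.
Proof.
have : U *m (U^T *m U) = U by rewrite mulmxA UUt mul1mx.
rewrite UtU mulmxBr mulmx1 => /eqP.
by rewrite -subr_eq0 addrAC subrr add0r oppr_eq0 => /eqP.
Qed.
Let UD : U *m D = 0. Proof. by rewrite -eD mulmxA UK mul0mx. Qed.
Let ZD : Z *m D = 0.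
Proof.
by rewrite -[Z]mul1mx -ZZt -!mulmxA [Z^T *m _]mulmxA ZtZ mulmxBl eD (proj2 spD) subrr mulmx0.
Qed.
Let De : D *m K = D.
Proof. by rewrite -[D](proj1 spD) -[K]Kt -trmx_mul eD. Qed.
Let ZK : Z *m K = Z.
Proof.
have h : Z *m (Z^T *m Z) = Z by rewrite mulmxA ZZt mul1mx.
by rewrite -[in LHS]h ZtZ -mulmxA mulmxBl KK De -ZtZ h.
Qed.
Let DZt : D *m Z^T = 0. Proof. by rewrite -[D](proj1 spD) -trmx_mul ZD trmx0. Qed.
Let KUt : K *m U^T = 0. Proof. by rewrite -Kt -trmx_mul UK trmx0. Qed.
Let KZt : K *m Z^T = Z^T. Proof. by rewrite -Kt -trmx_mul ZK. Qed.
Let UZt : U *m Z^T = 0. Proof. by rewrite -KZt mulmxA UK mul0mx. Qed.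
Let ZUt : Z *m U^T = 0. Proof. by rewrite -[LHS]trmxK trmx_mul trmxK UZt trmx0. Qed.

Let KAt := mulmx_e2_At sd.
Let KA := mulmx_e2_A oA sd.
Let AK := mulmx_A_e2 sd.
Let AtK := mulmx_At_e2 oA sd.

(** The displacement [g] of the foot point lies in the range of [P] and has component [a0] in ker(A
    - I); [P] commutes with [K], so it fixes [a0]. Moreover (q - v)(A^T - 1) = g - a0 is killed by 1
    - P, so (q - v)(1 - P) is fixed by [A]. *)
Lemma Gamma_split_facts k c : Gamma A a k c ->
  [/\ is_proj k c.1, c.1 *m A = A *m c.1, c.1 *m K = K *m c.1,
      (D *m c.1 = D) * (c.1 *m D = D) &
      ((c.2 - v + v *m c.1) *m c.1 = 0) * ((c.2 - v + v *m c.1) *m K = c.2 - v + v *m c.1)].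
Proof.
case: c => P q /(Gamma_comm _ _ _ oA)[[/= prP /= qP] /= PA]; rewrite /aff_apply.
have [Pt PP _] := prP.
have [PK _] := sd_comm sd Pt PA 2; 
set g := q *m A^T + a - q => gP.
have aK : a *m K = a0.
  by rewrite aE mulmxBl a0e -mulmxA mulmxBl AtK mul1mx subrr mulmx0 subr0.
have gK : g *m K = a0.
  by rewrite /g mulmxBl mulmxDl -mulmxA AtK aK addrAC subrr add0r.
have a0P : a0 *m P = a0 by rewrite -gK -mulmxA -PK mulmxA gP.
have DPD := DP a0P.
have PD : P *m D = D.
  by rewrite -[D](proj1 spD) -Pt -trmx_mul DPD.
split=> //; split; first by rewrite mulmxDl mulmxBl qP -mulmxA PP sub0r addNr.
apply: (fixed_e2 oA sd).
have -> : q - v + v *m P = (q - v) *m (1%:M - P).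
  by rewrite mulmxBr mulmx1 mulmxBl qP sub0r opprK.
have gE : (q - v) *m (A^T - 1%:M) = g - a0.
  rewrite /g aE mulmxBl [q *m (_ - _)]mulmxBr mulmx1.
  move: (v *m _) (q *m _) => x y.
  by apply/rowP => j; rewrite !mxE; ring.
have PAt := comm_tr Pt PA.
apply/eqP; rewrite -subr_eq0 -[X in _ - X]mulmx1 -mulmxBr -mulmxA.
have -> : (1%:M - P) *m (A^T - 1%:M) = (A^T - 1%:M) *m (1%:M - P).
  by rewrite mulmxBl !mulmxBr !mulmx1 !mul1mx mulmxBl PAt mul1mx.
rewrite mulmxA gE mulmxBr mulmx1 mulmxBl gP a0P subrr //.
Qed.

Lemma flat_split_union k c : Gamma A a k c ->
  @union_set R m l d k phi (flat_split c).
Proof.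
case: c => P q /Gamma_split_facts[/= [Pt PP rP] PA PK [DPD PDD] [q1 q2]].
set P1 := U *m P *m U^T; set P2 := Z *m P *m Z^T.
have P1t : P1^T = P1 by rewrite /P1 !trmx_mul trmxK Pt mulmxA.
have P2t : P2^T = P2 by rewrite /P2 !trmx_mul trmxK Pt mulmxA.
have compl : (1%:M - K) *m P = P *m (1%:M - K).
  by rewrite mulmxBl mulmxBr mul1mx mulmx1 PK.
have KK1 : (1%:M - K) *m (1%:M - K) = 1%:M - K.
  by rewrite mulmxBl mul1mx mulmxBr mulmx1 KK subrr subr0.
have P1P1 : P1 *m P1 = P1.
  rewrite /P1 -!mulmxA [U^T *m (U *m _)]mulmxA UtU mulmxBl mul1mx.
  rewrite [K *m (P *m _)]mulmxA -PK -[P *m K *m _]mulmxA KUt mulmx0 subr0.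
  by rewrite [P *m (P *m _)]mulmxA PP.
have PZP : P *m (K - D) *m P = K *m P - D.
  by rewrite mulmxBr mulmxBl PK PDD DPD -mulmxA PP.
have P2P2 : P2 *m P2 = P2.
  rewrite /P2 !mulmxA -[_ *m Z^T *m Z]mulmxA ZtZ -[Z *m P *m _]mulmxA -[Z *m _ *m P]mulmxA.
  by rewrite PZP mulmxBr ZD subr0 [Z *m (K *m P)]mulmxA ZK.
have trP : \tr P = \tr P1 + d%:R + \tr P2.
  rewrite /P1 /P2 ![\tr (_ *m _ *m _)]mxtrace_mulC !mulmxA UtU ZtZ -trD.
  by rewrite !mulmxBl mul1mx DPD !linearB /=; ring.
(* The trace of [P] splits along 1 - K, [D] and K - D; this one identity gives every dimension
   condition of [union_set]. *)
have rk : k = (\rank P1 + d + \rank P2)%N.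
  apply/eqP; rewrite -(eqr_nat R) -rP !natrD -!mxtrace_idem// trP //.
rewrite /union_set /flat_split /= -/P1 -/P2; split.
- by rewrite rk -addnA leq_addr.
- apply/Sinv_comm => //; split=> //; apply/Ucomm => //.
  have -> : U^T *m P1 *m U = (1%:M - K) *m P.
    rewrite /P1 !mulmxA UtU -[_ *m U^T *m U]mulmxA UtU compl -mulmxA KK1 //.
  rewrite -mulmxA PA !mulmxA; congr (_ *m P).
  by rewrite mulmxBl mulmxBr mul1mx mulmx1 KA AK.
- by rewrite rk -addnA addKn leq_addr.
- split=> /=.
    by split=> //; rewrite rk; lia.
  rewrite /P2 -!mulmxA [Z^T *m (Z *m _)]mulmxA ZtZ mulmxBl mulmxBr [_ *m (K *m _)]mulmxA.
  rewrite q2 [D *m (P *m _)]mulmxA DPD DZt mulmx0 subr0 mulmxA q1 mul0mx //.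
Qed.

(** [W], [D] and [V] are mutually orthogonal projections commuting with [A]: the first by the choice
    of [U], the others because [A] is the identity on their ranges. *)
Lemma flat_join_Gamma k z : @union_set R m l d k phi z -> Gamma A a k (flat_join z).
Proof.
case: z => k1 [P1 [P2 q2]] [/= le1 /(Sinv_comm _ _ ophi)[[P1t P1P1 rP1] P1phi] le2].
case=> -[/= P2t P2P2 rP2] q2P2.
have [W WE] : exists W, W = U^T *m P1 *m U by eexists.
have [V VE] : exists V, V = Z^T *m P2 *m Z by eexists.
rewrite /flat_join /= -WE -VE.
have Wt : W^T = W by rewrite WE !trmx_mul trmxK P1t mulmxA.
have Vt : V^T = V by rewrite VE !trmx_mul trmxK P2t mulmxA.
have WW : W *m W = W.
  rewrite WE !mulmxA -[_ *m U *m U^T]mulmxA UUt mulmx1.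
  by rewrite -[_ *m P1 *m P1]mulmxA P1P1.
have VV : V *m V = V.
  rewrite VE !mulmxA -[_ *m Z *m Z^T]mulmxA ZZt mulmx1.
  by rewrite -[_ *m P2 *m P2]mulmxA P2P2.
have WD : W *m D = 0 by rewrite WE -!mulmxA UD !mulmx0.
have WV : W *m V = 0 by rewrite WE VE !mulmxA -[_ *m U *m Z^T]mulmxA UZt mulmx0 !mul0mx.
have DV : D *m V = 0 by rewrite VE !mulmxA DZt !mul0mx.
have [P PE] : exists P, P = W + D + V by eexists.
rewrite -PE.
have spWD : sproj (W + D) by apply: sprojD.
have [Pt PP] : sproj P.
  by rewrite PE; apply: sprojD => //; rewrite mulmxDl WV DV addr0.
have trP : \tr P = k%:R.
  rewrite PE !linearD /= trD WE VE ![\tr (_ *m _ *m _)]mxtrace_mulC !mulmxA UUt ZZt !mul1mx.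
  by rewrite !mxtrace_idem// rP1 rP2 -!natrD; congr (_%:R); lia.
have q2P : q2 *m Z *m P = 0.
  rewrite PE !mulmxDr -[_ *m D]mulmxA ZD mulmx0 addr0 WE VE !mulmxA.
  rewrite -[_ *m Z *m U^T]mulmxA ZUt mulmx0 !mul0mx add0r.
  by rewrite -[_ *m Z *m Z^T]mulmxA ZZt mulmx1 q2P2 mul0mx.
have KV : K *m V = V by rewrite VE !mulmxA KZt.
have VK : V *m K = V by rewrite VE -!mulmxA ZK.
have VA : V *m A = V by rewrite -[in LHS]VK -mulmxA KA VK.
have AV : A *m V = V by rewrite -[in LHS]KV mulmxA AK KV.
have DA : D *m A = D by rewrite -[in LHS]De -mulmxA KA De.
have AD : A *m D = D by rewrite -[in LHS]eD mulmxA AK eD.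
have WA : W *m A = A *m W by rewrite WE; apply/Ucomm.
have PA : P *m A = A *m P by rewrite PE !mulmxDl !mulmxDr VA AV DA AD WA.
have PAt := comm_tr Pt PA.
have ZAt : Z *m A^T = Z by rewrite -[in LHS]ZK -mulmxA KAt ZK.
have DPe : D *m P = D.
  by rewrite PE !mulmxDr DV addr0 (proj2 spD) (mulmx_0sym Wt (proj1 spD) WD) add0r.
have a0P : a0 *m P = a0 by rewrite -[in LHS]a0D -mulmxA DPe a0D.
apply/Gamma_comm => //; split=> //=.
  split=> /=; last by rewrite mulmxBl mulmxDl q2P -mulmxA PP add0r subrr.
  split=> //; apply/eqP; rewrite -(eqr_nat R) -mxtrace_idem// trP //.
(* Rebasing at [v] adds to the displacement [a0] only a vector in the range of [P]. *)
have -> : aff_apply A a (q2 *m Z + v - v *m P) - (q2 *m Z + v - v *m P) =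
    a0 - v *m (A^T - 1%:M) *m P.
  rewrite /aff_apply aE mulmxBl mulmxDl -[q2 *m Z *m A^T]mulmxA ZAt.
  rewrite !mulmxBr !mulmx1 mulmxBl -[v *m P *m _]mulmxA PAt mulmxA.
  by apply/rowP => j; rewrite !mxE; ring.
by rewrite mulmxBl a0P -[_ *m P *m P]mulmxA PP.
Qed.

(** The pieces of [P] come back as P - K P, [D] and K P - D, which telescope. *)
Lemma flat_splitK k c : Gamma A a k c -> flat_join (flat_split c) = c.
Proof.
case: c => P q /Gamma_split_facts[/= [Pt PP rP] PA PK [DPD PDD] [q1 q2]].
rewrite /flat_join /flat_split /=.
have KPK : K *m P *m K = K *m P by rewrite -mulmxA PK mulmxA KK.
have h1 : U^T *m (U *m P *m U^T) *m U = P - K *m P.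
  rewrite !mulmxA UtU -[_ *m U^T *m U]mulmxA UtU mulmxBl mul1mx.
  by rewrite mulmxBr mulmx1 mulmxBl KPK PK subrr subr0.
have h2 : Z^T *m (Z *m P *m Z^T) *m Z = K *m P - D.
  rewrite !mulmxA ZtZ -[_ *m Z^T *m Z]mulmxA ZtZ mulmxBl DPD.
  by rewrite mulmxBr !mulmxBl KPK De -[K *m P *m D]mulmxA PDD eD (proj2 spD) subrr subr0.
have -> : U^T *m (U *m P *m U^T) *m U + D + Z^T *m (Z *m P *m Z^T) *m Z = P.
  by rewrite h1 h2 addrA addrAC addrK subrK.
have qD : (q - v + v *m P) *m D = 0 by rewrite -PDD mulmxA q1 mul0mx.
congr pair.
rewrite -mulmxA ZtZ mulmxBr q2 qD subr0.
by apply/rowP => j; rewrite !mxE; ring.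
Qed.

Lemma flat_joinK k z : @union_set R m l d k phi z -> flat_split (flat_join z) = z.
Proof.
case: z => k1 [P1 [P2 q2]] [/= le1 /(Sinv_comm _ _ ophi)[[P1t P1P1 rP1] P1phi] le2].
case=> -[/= P2t P2P2 rP2] q2P2.
rewrite /flat_join /flat_split /=; set P := U^T *m P1 *m U + D + Z^T *m P2 *m Z.
have -> : U *m P *m U^T = P1.
  rewrite /P !mulmxDr UD addr0 !mulmxA UUt UZt !mul0mx addr0 mul1mx.
  by rewrite -mulmxA UUt mulmx1.
have -> : Z *m P *m Z^T = P2.
  rewrite /P !mulmxDr ZD addr0 !mulmxA ZUt ZZt !mul0mx add0r mul1mx.
  by rewrite -mulmxA ZZt mulmx1.
rewrite rP1; do 3!congr pair.
have -> : q2 *m Z + v - v *m P - v + v *m P = q2 *m Z.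
  by apply/rowP => j; rewrite !mxE; ring.
by rewrite -mulmxA ZZt mulmx1.
Qed.

Let mdist2_ge0 p q r s (x y : 'M[R]_(p, q) * 'M[R]_(r, s)) :
  0 <= pdist (@mdist R p q) (@mdist R r s) x y.
Proof. exact/pdist_ge0/mdist_ge0. Qed.

(** The tag is a rank, hence on projections a trace: Lipschitz and integer valued, so nearby flats
    have equal tags. The constant [C] controls the components and [T] the tag. *)
Lemma flat_split_cont k :
  cont_on (pdist (@mdist R n n) (@mdist R 1 n))
    (tdist (pdist (@mdist R m m) (pdist (@mdist R l l) (@mdist R 1 l))))
    (Gamma A a k) flat_split.
Proof.
pose dX := pdist (@mdist R n n) (@mdist R 1 n).
have dX0 : forall x y, 0 <= dX x y by apply: mdist2_ge0.
have l1 : lipschitz dX (@mdist R _ _) fst by exact: lipschitz_fst (lipschitz_id dX).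
have l2 : lipschitz dX (@mdist R _ _) snd by exact: lipschitz_snd (lipschitz_id dX).
have lP1 : lipschitz dX (@mdist R _ _) (fun c => U *m c.1 *m U^T).
  exact/lipschitz_mulmxr/lipschitz_mulmxl.
have lP2 : lipschitz dX (@mdist R _ _) (fun c => Z *m c.1 *m Z^T).
  exact/lipschitz_mulmxr/lipschitz_mulmxl.
have lq : lipschitz dX (@mdist R _ _) (fun c => (c.2 - v + v *m c.1) *m Z^T).
  apply: lipschitz_mulmxr => //; apply: lipschitzD => //.
    by apply: lipschitzD => //; exact: lipschitz_cst.
  exact: lipschitz_mulmxl.
have [C C0 hC] := lipschitz_pair dX0 lP1 (lipschitz_pair dX0 lP2 lq).
have [T T0 hT] := lipschitz_trace lP1.
apply: (@cont_on_local_lipschitz _ _ _ _ _ _ _ (C + T)) => [|x y Gx Gy small _].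
  exact: addr_ge0.
rewrite /tdist /=; case: eqP => [_|neq].
  by apply: le_trans (hC x y) _; rewrite ler_wpM2r// lerDl.
case: neq; apply/eqP; rewrite -(eqr_nat R).
have [_ /(Sinv_comm _ _ ophi)[[_ xx _] _] _ _] := flat_split_union Gx.
have [_ /(Sinv_comm _ _ ophi)[[_ yy _] _] _ _] := flat_split_union Gy.
have := hT x y; rewrite !mxtrace_idem// => h.
have {small}h : `|(\rank (U *m x.1 *m U^T))%:R - (\rank (U *m y.1 *m U^T))%:R| < 1 :> R.
  by apply: le_lt_trans h _; apply: le_lt_trans small; rewrite ler_wpM2r// lerDr.
exact/eqP/congr1/(natr_dist_lt1 h).
Qed.

Lemma flat_join_cont k :
  cont_on (tdist (pdist (@mdist R m m) (pdist (@mdist R l l) (@mdist R 1 l))))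
    (pdist (@mdist R n n) (@mdist R 1 n))
    (@union_set R m l d k phi) flat_join.
Proof.
pose dX := pdist (@mdist R m m) (pdist (@mdist R l l) (@mdist R 1 l)).
have dX0 : forall x y, 0 <= dX x y by apply/pdist_ge0/mdist_ge0.
have li := lipschitz_id dX.
have l1 : lipschitz dX (@mdist R _ _) fst by exact: lipschitz_fst li.
have l2 : lipschitz dX (@mdist R _ _) (fun z => z.2.1).
  exact: lipschitz_fst (lipschitz_snd li).
have l3 : lipschitz dX (@mdist R _ _) (fun z => z.2.2).
  exact: lipschitz_snd (lipschitz_snd li).
have lP : lipschitz dX (@mdist R _ _)
    (fun z => U^T *m z.1 *m U + D + Z^T *m z.2.1 *m Z).
  apply: lipschitzD => //.
    apply: lipschitzD => //; last exact: lipschitz_cst.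
    exact/lipschitz_mulmxr/lipschitz_mulmxl.
  exact/lipschitz_mulmxr/lipschitz_mulmxl.
have lq : lipschitz dX (@mdist R _ _)
    (fun z => z.2.2 *m Z + v - v *m (U^T *m z.1 *m U + D + Z^T *m z.2.1 *m Z)).
  apply: lipschitzD => //.
    by apply: lipschitzD => //; [exact: lipschitz_mulmxr | exact: lipschitz_cst].
  by apply: lipschitzN => //; exact: lipschitz_mulmxl.
have [C C0 hC] := lipschitz_pair dX0 lP lq.
apply: (@cont_on_local_lipschitz _ _ _ _ _ _ _ C) => [//|[i x] [j y] _ _ _].
(* Different tags are at distance exactly 1, which the local bound excludes. *)
rewrite /tdist /=; case: eqP => [_ _|_]; last by rewrite ltxx.
exact: hC.
Qed.

Lemma Gamma_homeomorphic k :
  homeomorphic (pdist (@mdist R n n) (@mdist R 1 n))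
    (tdist (pdist (@mdist R m m) (pdist (@mdist R l l) (@mdist R 1 l))))
    (Gamma A a k) (@union_set R m l d k phi).
Proof.
exists flat_split, flat_join; split; last split.
- exact: flat_split_union.
- exact: flat_join_Gamma.
- exact: flat_splitK.
- exact: flat_joinK.
- exact: flat_split_cont.
- exact: flat_join_cont.
Qed.

End Homeomorphism.

Unset Implicit Arguments.

Theorem mainTheorem9 (R : rcfType) (n : nat) (A : 'M[R]_n) (a : 'rV[R]_n)
  (s : seq nat) (phiR : 'M[R]_(n - kerdim (A - 1%:M))) (d : nat) :
  orth_mx A ->
  segre_tilde A s ->
  orth_mx phiR ->
  kerdim (phiR - 1%:M) = 0%N ->
  segre_tilde phiR s ->
  (d = 0%N /\ elliptic A a) \/ (d = 1%N /\ ~ elliptic A a) ->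
  (forall k : nat,
     homeomorphic
       (pdist (@mdist R n n) (@mdist R 1 n))
       (tdist (pdist (@mdist R _ _)
                     (pdist (@mdist R (kerdim (A - 1%:M) - d) (kerdim (A - 1%:M) - d))
                            (@mdist R 1 (kerdim (A - 1%:M) - d)))))
       (Gamma A a k)
       (@union_set R _ (kerdim (A - 1%:M) - d) d k phiR))
  /\ (d = 1%N -> forall c, ~ Gamma A a 0 c).
Proof.
move=> oA sA oB B1 sB hd.
have [mu [e [J sd]]] := orth_spectral oA.
have [mu' [e' [J' sd']]] := orth_spectral oB.
have [U [UUt UtU Ucomm]] := exists_matching_isometry oA oB sd sd' sA sB B1 erefl.
have [v [a0 [aE a0e a0_ell]]] := affine_normal_form a oA sd.
have hd' : (d = 0%N /\ a0 = 0) \/ (d = 1%N /\ a0 != 0).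
  case: hd => -[-> ell]; [left | right]; split=> //.
    by apply/eqP/a0_ell.
  by apply/negP => /a0_ell.
have [D [Z [spD trD a0D [eD DP ZZt ZtZ]]]] := translation_frame oA sd a0e hd'.
split=> [k|d1 c].
  exact: (Gamma_homeomorphic oA oB sd aE a0e UUt UtU Ucomm spD trD a0D eD DP ZZt ZtZ).
case: hd => -[dE ell]; first by rewrite dE in d1.
(* A projection of rank 0 is zero, so the displacement of the foot point vanishes and this point is
   fixed. *)
move=> /(Gamma_comm _ _ _ oA)[[[_ _ /eqP]]]; rewrite mxrank_eq0 => /eqP-> _ _.
rewrite mulmx0 => /esym/eqP; rewrite subr_eq0 => /eqP fix_c.
by apply: ell; exists c.2.
Qed.
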